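(* Let $k=\mathbb{Z}[y^2]$ and let $m\ge 1$. The fourth homology of the normalized Yang-Baxter operator $R_{(m)}$ is, as a $k$-module, $$H_4(R_{(m)})\cong k^{\oplus\left(\binom{m-1}{0}+\binom{m-1}{1}+\binom{m-1}{2}+\binom{m-1}{3}+\binom{m-1}{4}\right)}\oplus\left(\frac{k}{(1-y^2)}\right)^{\oplus\left(6\binom{m-1}{1}+33\binom{m-1}{2}+51\binom{m-1}{3}+23\binom{m-1}{4}\right)}\oplus\left(\frac{k}{(1-y^4)}\right)^{\oplus\left(4\binom{m-1}{1}+6\binom{m-1}{2}+3\binom{m-1}{3}\right)},$$ that is, $H_4(R_{(m)})\cong k^{a}\oplus (k/(1-y^2))^{b}\oplus (k/(1-y^4))^{c}$ with $$a=\frac{m^4-6m^3+23m^2-18m+24}{24},\quad b=\frac{(m-1)(23m^3-3m^2-26m+24)}{24},\quad c=\frac{(m-1)(m^2+m+2)}{2}.$$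
   Context: Here $k=\mathbb{Z}[y^2]$ is the polynomial ring over $\mathbb{Z}$ in the variable $y^2$, and $y^4=(y^2)^2$. For $m\ge 1$ let $X_{(m)}=\{v_1,\dots,v_m\}$ be ordered by $v_i<v_j$ iff $i<j$, and let $V_{(m)}=kX_{(m)}$ be the free $k$-module on $X_{(m)}$. Basis elements $a_1\otimes\cdots\otimes a_n$ of $V_{(m)}^{\otimes n}$ (with $a_i\in X_{(m)}$) are written as tuples $(a_1,\dots,a_n)$. The normalized Yang-Baxter operator (yielding the HOMFLYPT polynomial) $R_{(m)}:V_{(m)}\otimes V_{(m)}\to V_{(m)}\otimes V_{(m)}$ is the $k$-linear map with $R_{(m)}(a,b)=(b,a)$ if $a\ge b$, and $R_{(m)}(a,b)=(1-y^2)(a,b)+y^2(b,a)$ if $a<b$. Chain complex $C_\bullet^m$: $C_n^m=V_{(m)}^{\otimes n}$ for $n\ge 0$ ($C_0^m=k$). For $1\le i\le n$, $d_i^{\ell}:C_n^m\to C_{n-1}^m$ applies $R_{(m)}$ to tensor positions $(i-1,i)$, then $(i-2,i-1)$, ..., then $(1,2)$, and then deletes the first tensor factor of each basis tuple; $d_i^{r}:C_n^m\to C_{n-1}^m$ applies $R_{(m)}$ to positions $(i,i+1)$, then $(i+1,i+2)$, ..., then $(n-1,n)$, and then deletes the last tensor factor of each basis tuple. The differential is $\partial_n=\sum_{i=1}^n(-1)^i(d_i^{\ell}-d_i^{r})$, and $H_n(R_{(m)})=H_n(C_\bullet^m)=\ker\partial_n/\operatorname{im}\partial_{n+1}$. 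*)

(* Defs.v *)
From HB Require Import structures.
From mathcomp Require Import all_boot all_order all_algebra.
From mathcomp Require Import boolp.

Set Implicit Arguments.
Unset Strict Implicit.
Unset Printing Implicit Defensive.

Import GRing.Theory.
Local Open Scope ring_scope.

(** * Quotient modules *)

Section QuotientModule.
Variables (R : nzRingType) (M : lmodType R) (S : submodClosed M).

Definition submod_zmodClosed : zmodClosed M :=
  HB.pack (GRing.SubmodClosed.sort S)
    (GRing.isZmodClosed.Build M (GRing.SubmodClosed.sort S)
       (GRing.submod_closedB (GRing.submodClosedP S))).

(* The library's quotient of abelian groups, equipped below with the induced
   action of [R]. *)
Definition quotmod := @Quotient.quot M submod_zmodClosed.

HB.instance Definition _ := GRing.Zmodule.on quotmod.

Definition to_quotmod : M -> quotmod :=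
  \pi_(@Quotient.quot M submod_zmodClosed)%qT.

Definition quotmod_repr (u : quotmod) : M :=
  repr (u : @Quotient.quot M submod_zmodClosed).

Lemma quotmod_reprK : cancel quotmod_repr to_quotmod.
Proof. exact: reprK. Qed.

Lemma eq_to_quotmod (x y : M) : (to_quotmod x == to_quotmod y) = (x - y \in S).
Proof. exact: (esym (Quotient.idealrBE submod_zmodClosed x y)). Qed.

Lemma to_quotmodD : {morph to_quotmod : x y / x + y}.
Proof. exact: (raddfD \pi_(@Quotient.quot M submod_zmodClosed)%qT). Qed.

Definition quotmod_scale (a : R) (u : quotmod) : quotmod :=
  to_quotmod (a *: quotmod_repr u).

Lemma quotmod_scaleE (a : R) (x : M) :
  quotmod_scale a (to_quotmod x) = to_quotmod (a *: x).
Proof.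
apply/eqP; rewrite eq_to_quotmod -scalerBr rpredZ // -eq_to_quotmod.
by rewrite quotmod_reprK.
Qed.

Lemma quotmod_scaleA a b u :
  quotmod_scale a (quotmod_scale b u) = quotmod_scale (a * b) u.
Proof. by rewrite -[u]quotmod_reprK !quotmod_scaleE scalerA. Qed.

Lemma quotmod_scale1 : left_id 1 quotmod_scale.
Proof. by move=> u; rewrite -[u]quotmod_reprK quotmod_scaleE scale1r. Qed.

Lemma quotmod_scaleDr : right_distributive quotmod_scale +%R.
Proof.
move=> a u v; rewrite -[u]quotmod_reprK -[v]quotmod_reprK -to_quotmodD.
by rewrite !quotmod_scaleE scalerDr to_quotmodD.
Qed.

Lemma quotmod_scaleDl u : {morph quotmod_scale^~ u : a b / a + b}.
Proof.
by move=> a b; rewrite -[u]quotmod_reprK !quotmod_scaleE scalerDl to_quotmodD.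
Qed.

HB.instance Definition _ := GRing.Zmodule_isLmodule.Build R quotmod
  quotmod_scaleA quotmod_scale1 quotmod_scaleDr quotmod_scaleDl.

Lemma to_quotmod_is_linear : linear to_quotmod.
Proof. by move=> a x y; rewrite to_quotmodD -quotmod_scaleE. Qed.

HB.instance Definition _ :=
  GRing.isLinear.Build R M quotmod *:%R to_quotmod to_quotmod_is_linear.

End QuotientModule.

(** * Homology of a pair of composable linear maps *)

Section Kernel.
Variables (R : nzRingType) (U V : lmodType R) (f : {linear U -> V}).

Definition ker_pred : {pred U} := fun x => f x == 0.

Lemma ker_pred_submod : submod_closed ker_pred.
Proof.
split=> [|a x y]; first by rewrite unfold_in /ker_pred raddf0.
by rewrite !unfold_in /ker_pred linearP => /eqP-> /eqP->; rewrite scaler0 addr0.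
Qed.

HB.instance Definition _ := GRing.isSubmodClosed.Build R U ker_pred
  ker_pred_submod.

Record kernel := Kernel { kernel_val :> U; _ : kernel_val \in ker_pred }.

HB.instance Definition _ := [isSub for kernel_val].
HB.instance Definition _ := [Choice of kernel by <:].
HB.instance Definition _ := [SubChoice_isSubLmodule of kernel by <:].

End Kernel.

Section Homology.
Variables (R : nzRingType) (U V W : lmodType R).
Variables (f : {linear V -> W}) (g : {linear U -> V}).

(* The image of [g], as a set of elements of [ker f]. When [f \o g = 0], which
   holds for a chain complex, this is the whole image of [g]. *)
Definition bound_pred : {pred kernel f} := fun z => `[< exists c, val z = g c >].

Lemma bound_pred_submod : submod_closed bound_pred.
Proof.
split=> [|a x y]; rewrite !unfold_in /bound_pred.
  by apply/asboolP; exists 0; rewrite !raddf0.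
move=> /asboolP[c xc] /asboolP[d yd]; apply/asboolP; exists (a *: c + d).
by rewrite linearP -xc -yd linearP.
Qed.

HB.instance Definition _ := GRing.isSubmodClosed.Build R (kernel f) bound_pred
  bound_pred_submod.

Definition homology := quotmod bound_pred.

HB.instance Definition _ := GRing.Lmodule.on homology.

End Homology.

(** * Cyclic modules and isomorphisms *)

Section Cyclic.
Variables (R : comNzRingType) (p : R).

Definition principal_pred : {pred R^o} := fun q => `[< exists r, q = r * p >].

Lemma principal_pred_submod : submod_closed principal_pred.
Proof.
split=> [|a x y]; rewrite !unfold_in /principal_pred.
  by apply/asboolP; exists 0; rewrite mul0r.
move=> /asboolP[c ->] /asboolP[d ->]; apply/asboolP; exists (a * c + d).
by rewrite mulrDl -mulrA.
Qed.

HB.instance Definition _ := GRing.isSubmodClosed.Build R R^o principal_pred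
  principal_pred_submod.

Definition cyclic_mod := quotmod principal_pred.

HB.instance Definition _ := GRing.Lmodule.on cyclic_mod.

End Cyclic.

Definition lmod_isomorphic (R : nzRingType) (U V : lmodType R) : Prop :=
  exists f : {linear U -> V}, bijective f.

(** * Free modules on finite sets *)

Section FreeModule.
Variable R : comNzRingType.

Definition free_mod (X : finType) := {ffun X -> R^o}.

HB.instance Definition _ (X : finType) := GRing.Lmodule.on (free_mod X).

Definition basis_elt (X : finType) (x : X) : free_mod X :=
  [ffun z => (z == x)%:R].

Definition linear_ext (X : finType) (M : lmodType R) (h : X -> M)
  (v : free_mod X) : M := \sum_(x : X) (v x : R) *: h x.

Lemma linear_ext_is_linear (X : finType) (M : lmodType R) (h : X -> M) :
  linear (linear_ext h).
Proof.
move=> a u v; rewrite /linear_ext scaler_sumr -big_split /=.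
by apply: eq_bigr => x _; rewrite !ffunE scalerDl scalerA.
Qed.

HB.instance Definition _ (X : finType) (M : lmodType R) (h : X -> M) :=
  GRing.isLinear.Build R (free_mod X) M *:%R (linear_ext h)
    (@linear_ext_is_linear X M h).

End FreeModule.

Arguments basis_elt {R X} x.

(** * The normalized Yang-Baxter operator and its chain complex *)

(* The ring Z[y^2]; the indeterminate 'X of {poly int} plays the role of y^2,
   so that y^4 is 'X^2. *)
Notation k := {poly int}.
Notation y2 := ('X : k).

Section YangBaxter.
Variable m : nat.

(* The basis element v_(i+1) is represented by i : 'I_m. *)
Notation X := 'I_m.

(* V (x) V, with basis the pairs of elements of X, is [free_mod k (X * X)]. *)
Definition YB_basis (ab : X * X) : free_mod k (X * X)%type :=
  let: (a, b) := ab in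
  if (b <= a)%N then basis_elt (b, a)
  else (1 - y2) *: basis_elt (a, b) + y2 *: basis_elt (b, a).

Definition YB : free_mod k (X * X)%type -> free_mod k (X * X)%type :=
  linear_ext YB_basis.

HB.instance Definition _ := GRing.Linear.on YB.

Definition chain (n : nat) := free_mod k (n.-tuple X).

HB.instance Definition _ n := GRing.Lmodule.on (chain n).

Section Faces.
Variable n : nat.

(* For j : 'I_n.-1, the adjacent tensor positions j and j + 1, counted from 0. *)
Definition pos1 (j : 'I_n.-1) : 'I_n := widen_ord (leq_pred n) j.
Definition pos2 (j : 'I_n.-1) : 'I_n := lift (pos1 j) j.

Lemma val_pos2 j : pos2 j = j.+1 :> nat.
Proof. by rewrite /= /bump leqnn. Qed.

Definition replace2 (t : n.-tuple X) (j : 'I_n.-1) (ab : X * X) : n.-tuple X :=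
  [tuple if l == pos1 j then ab.1 else if l == pos2 j then ab.2 else tnth t l
     | l < n].

(* id (x) ... (x) YB (x) ... (x) id, with YB in positions j and j + 1. *)
Definition YB_at (j : 'I_n.-1) : chain n -> chain n :=
  linear_ext (fun t : n.-tuple X =>
    linear_ext (fun ab => basis_elt (replace2 t j ab) : chain n)
      (YB (basis_elt (tnth t (pos1 j), tnth t (pos2 j))))).

Definition delete_first : chain n -> chain n.-1 :=
  linear_ext (fun t : n.-tuple X => basis_elt (behead_tuple t) : chain n.-1).

Definition delete_last : chain n -> chain n.-1 :=
  linear_ext (fun t : n.-tuple X =>
    basis_elt [tuple tnth t (widen_ord (leq_pred n) l) | l < n.-1] : chain n.-1).

HB.instance Definition _ j := GRing.Linear.on (YB_at j).
HB.instance Definition _ := GRing.Linear.on delete_first.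
HB.instance Definition _ := GRing.Linear.on delete_last.

(* With i counted from 0: [face_l i] applies [YB_at (i - 1)] first, then
   [YB_at (i - 2)], and so on down to [YB_at 0]; [face_r i] applies [YB_at i]
   first, then [YB_at (i + 1)], and so on up to [YB_at (n - 2)]. *)
Definition face_l (i : 'I_n) (c : chain n) : chain n.-1 :=
  delete_first (foldr YB_at c [seq j : 'I_n.-1 <- enum 'I_n.-1 | (j < i)%N]).

Definition face_r (i : 'I_n) (c : chain n) : chain n.-1 :=
  delete_last (foldl (fun c' j => YB_at j c') c
                 [seq j : 'I_n.-1 <- enum 'I_n.-1 | (i <= j)%N]).

(* The exponent is i + 1 because i is counted from 0. For n = 0 the sum is empty,
   so that [boundary] is the zero map. *)
Definition boundary (c : chain n) : chain n.-1 :=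
  \sum_(i < n) (-1 : k) ^+ i.+1 *: (face_l i c - face_r i c).

Lemma face_l_is_linear i : linear (face_l i).
Proof.
move=> a u v; rewrite /face_l -linearP; congr (delete_first _).
by elim: [seq j <- _ | _] => //= j s ->; rewrite linearP.
Qed.

Lemma face_r_is_linear i : linear (face_r i).
Proof.
move=> a u v; rewrite /face_r -linearP; congr (delete_last _).
by elim: [seq j <- _ | _] u v => //= j s IHs u v; rewrite linearP IHs.
Qed.

Lemma boundary_is_linear : linear boundary.
Proof.
move=> a u v; rewrite /boundary scaler_sumr -big_split /=.
apply: eq_bigr => i _; rewrite face_l_is_linear face_r_is_linear.
rewrite opprD addrACA -scalerBr scalerDr; congr (_ + _).
by rewrite !scalerA mulrC.
Qed.

HB.instance Definition _ :=
  GRing.isLinear.Build k (chain n) (chain n.-1) *:%R boundary boundary_is_linear.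

End Faces.

Definition YB_homology (n : nat) : lmodType k :=
  @homology k (chain n.+1) (chain n) (chain n.-1)
    (@boundary n) (@boundary n.+1).

End YangBaxter.

(* Main.v *)
From HB Require Import structures.
Require Import Defs.
From mathcomp Require Import all_boot all_order all_algebra.
From mathcomp Require Import zify ring boolp.
Set Implicit Arguments.
Unset Strict Implicit.
Unset Printing Implicit Defensive.
Import GRing.Theory.
Local Open Scope ring_scope.

(** The proof reduces the homology for all m to five finite computations.

    A weakly monotone map between sets of letters induces a chain map
    ([push_boundary]): when two letters a < b are merged, the two terms of the
    operator add up to (1 - y^2) + y^2 = 1, which is the flip on a repeated letter.
    The complex is therefore a functor of the ordered set of letters, and it splits in
    the manner of the Dold-Kan correspondence. Keep the smallest letter apart and let S
    run over the sets of other letters. The summand of S is the reduced complex on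
    the smallest letter and S, in which the words that miss a letter of S
    (the degenerate words) are set to zero; up to renaming of the letters it depends
    only on the cardinality of S. The projection to this summand is
    [push (rank_in S)], which lowers every letter to one of S or to the smallest, and
    the inclusion is the alternating sum [spread]; [rank_spread_same],
    [rank_spread_diff] and [degenerate_rank_inj] say that these maps are mutually
    inverse. There are as many summands with #|S| = p as p-subsets of a set of m - 1
    letters, whence the binomial coefficients.

    In degree 4 the reduced complex on p + 1 letters has rank 1, 15, 50, 60, 24 for
    p = 0, ..., 4, and it vanishes for p > 4, since a word of length 4 cannot
    contain p letters. At y^2 = 1 the operator is the flip, so that both faces with
    index i delete the i-th letter and the boundary is zero. Boundaries are thus
    divisible by 1 - y^2, which is why every torsion summand is a quotient by
    1 - y^2 or by a multiple of it. In each of the five cases the cycles have a basis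
    x_i such that the boundaries are spanned by the multiples (1 - y2 ^+ d_i) x_i with
    d_i in {0, 1, 2}; here d_i = 0 gives the factor 0, hence a free summand. Such a
    basis, found by Gaussian elimination, is recorded in [tables] as a list of chains
    of degree 5 which have the multiples (1 - y2 ^+ d_i) x_i as boundaries.
    [check_reduced_cyclic_basis] shows that a decidable test on sparse lists suffices
    for the validity of such a table, and [tables_checked] runs this test. The
    exponents of the theorem are the numbers of entries with a given d_i, weighted by
    the numbers of subsets S ([card_table_degree]). *)

(** * Homology with an adapted basis *)

Section QuotientIso.
Variables (R : nzRingType) (M P : lmodType R) (S : submodClosed M).

Lemma quotmod_isomorphic (g : M -> P) :
  linear g -> (forall x, x \in S <-> g x = 0) -> (forall y, exists x, g x = y) ->
  lmod_isomorphic (quotmod S) P.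
Proof.
move=> g_lin kerG surjG.
pose G := HB.pack g (GRing.isLinear.Build R M P *:%R g g_lin) : {linear M -> P}.
pose F (u : quotmod S) := G (quotmod_repr u).
have FE x : F (to_quotmod S x) = G x.
  apply/eqP; rewrite -subr_eq0 -[X in X == 0](raddfB G); apply/eqP/kerG.
  by rewrite -eq_to_quotmod quotmod_reprK.
have Flin : linear F.
  move=> a u v; rewrite -[u]quotmod_reprK -[v]quotmod_reprK -linearP !FE.
  exact: linearP.
pose FL := GRing.isLinear.Build R (quotmod S) P *:%R F Flin.
exists (HB.pack F FL : {linear quotmod S -> P}) => /=.
have [s sG] := choice surjG.
exists (fun y => to_quotmod S (s y)) => [u|y]; last by rewrite [LHS]FE; exact: sG.
rewrite -[RHS]quotmod_reprK; apply/eqP; rewrite eq_to_quotmod.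
apply/kerG; apply: (etrans (raddfB G _ _)); apply/eqP; rewrite subr_eq0; apply/eqP.
exact: sG.
Qed.

End QuotientIso.

Section CyclicBasis.
Variables (R : comNzRingType) (U V W : lmodType R).
Variables (f : {linear V -> W}) (g : {linear U -> V}).

(** The x i form a basis of the cycles in which the image of g is diagonal. Membership
    of the cycles in the span of the x i is encoded by the third condition: a cycle
    minus its expansion in the x i is a cycle on which all the phi i vanish. *)
Definition cyclic_basis (I : finType) (delta : I -> R) : Prop :=
  exists (x : I -> V) (phi : I -> {linear V -> R^o}),
    [/\ forall i, f (x i) = 0,
        forall i j, phi i (x j) = (i == j)%:R,
        forall v, f v = 0 -> (forall i, phi i v = 0) -> v = 0,
        forall i, exists u, g u = delta i *: x i
      & forall i u, exists r, phi i (g u) = r * delta i].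

Variables (I : finType) (d : I -> nat) (delta : nat -> R) (a b c : nat).

(** The map to the right-hand side sends a cycle to its coordinates phi i, each reduced
    modulo its own delta; delta 0 = 0 makes the first block free. *)
Lemma homology_cyclic_basis :
    delta 0 = 0 -> (forall i, d i < 3)%N ->
    #|[pred i | d i == 0%N]| = a -> #|[pred i | d i == 1%N]| = b ->
    #|[pred i | d i == 2%N]| = c ->
    cyclic_basis (fun i => delta (d i)) ->
  lmod_isomorphic (homology f g)
    ({ffun 'I_a -> R^o} * {ffun 'I_b -> cyclic_mod (delta 1)}
     * {ffun 'I_c -> cyclic_mod (delta 2)})%type.
Proof.
move=> delta0 d_lt3 <- <- <- [x [phi [fx phix phi_inj deltax phig]]].
pose e (n : nat) (j : 'I_#|[pred i | d i == n]|) : I := enum_val j.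
have de n j : d (@e n j) = n by apply/eqP/(enum_valP j).
have e_surj i : exists j, @e (d i) j = i.
  have ii : i \in [pred i0 | d i0 == d i] by rewrite inE.
  by exists (enum_rank_in ii i); rewrite /e enum_rankK_in.
pose q n : R^o -> cyclic_mod (delta n) := to_quotmod (@principal_pred R (delta n)).
have q_lin n : linear (q n).
  by move=> r s t; rewrite /q to_quotmodD -quotmod_scaleE.
have q0 n s : q n s = 0 <-> exists r, s = r * delta n.
  rewrite /q -[0](raddf0 (to_quotmod (@principal_pred R (delta n)))).
  split=> [/eqP|rP]; first by rewrite eq_to_quotmod subr0 => /asboolP.
  by apply/eqP; rewrite eq_to_quotmod subr0; apply/asboolP.
pose G (z : kernel f) : ({ffun 'I__ -> R^o} * {ffun 'I__ -> cyclic_mod (delta 1)}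
     * {ffun 'I__ -> cyclic_mod (delta 2)})%type :=
  ([ffun j => phi (@e 0 j) (val z)], [ffun j => q 1 (phi (@e 1 j) (val z))],
   [ffun j => q 2 (phi (@e 2 j) (val z))]).
have G_lin : linear G.
  move=> r y z; congr (_, _, _); apply/ffunP => j; rewrite !ffunE linearP //.
    exact: q_lin.
  exact: q_lin.
(* The goals: G vanishes exactly on the boundaries, and G is onto. *)
apply: (quotmod_isomorphic G_lin) => /= [z|[[y0 y1] y2]].
  have fz : f (val z) = 0 by apply/eqP; exact: valP z.
  split=> [/asboolP[u zu]|Gz].
    congr (_, _, _); apply/ffunP => j; rewrite !ffunE zu.
    - by have [r ->] := phig (e 0 j) u; rewrite de delta0 mulr0.
    - by apply/q0; have [r ->] := phig (e 1 j) u; rewrite de; exists r.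
    - by apply/q0; have [r ->] := phig (e 2 j) u; rewrite de; exists r.
  have im i : exists u, g u = phi i (val z) *: x i.
    have [r ->] : exists r, phi i (val z) = r * delta (d i).
      have [j <-] := e_surj i; have := d_lt3 i.
      move: j; case: (d i) => [|[|[|//]]] j _; rewrite de.
      - exists 0; rewrite mul0r; have /(congr1 fst)/(congr1 fst) := Gz.
        by move=> /ffunP/(_ j); rewrite !ffunE.
      - apply/q0; have /(congr1 fst)/(congr1 snd) := Gz.
        by move=> /ffunP/(_ j); rewrite !ffunE.
      - apply/q0; have /(congr1 snd) := Gz.
        by move=> /ffunP/(_ j); rewrite !ffunE.
    have [u gu] := deltax i; exists (r *: u).
    by rewrite linearZ /= gu scalerA.
  have [u gu] := choice im.
  apply/asboolP; exists (\sum_i u i); apply/eqP; rewrite -subr_eq0; apply/eqP.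
  rewrite linear_sum (eq_bigr _ (fun i _ => gu i)).
  apply: phi_inj => [|i].
    rewrite linearB fz linear_sum big1 ?subrr // => i _.
    by rewrite linearZ /= fx scaler0.
  rewrite linearB linear_sum (bigD1 i) //= linearZ /= phix eqxx big1 ?addr0.
    by rewrite [_ *: _]mulr1 subrr.
  by move=> j ji; rewrite linearZ /= phix eq_sym (negPf ji) scaler0.
pose v := \sum_j y0 j *: x (@e 0 j)
  + \sum_j quotmod_repr (y1 j) *: x (@e 1 j)
  + \sum_j quotmod_repr (y2 j) *: x (@e 2 j).
have phi_sum n (y : 'I_#|[pred i | d i == n]| -> R) i :
    phi i (\sum_j y j *: x (@e n j)) = \sum_j y j * (i == e n j)%:R.
  by rewrite linear_sum; apply: eq_bigr => j _; rewrite linearZ /= phix.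
have phi_eq n (y : 'I_#|[pred i | d i == n]| -> R) j :
    phi (e n j) (\sum_j y j *: x (@e n j)) = y j.
  rewrite phi_sum (bigD1 j) //= eqxx mulr1 big1 ?addr0 // => l lj.
  by rewrite (inj_eq enum_val_inj) eq_sym (negPf lj) mulr0.
have phi_neq n n' (y : 'I_#|[pred i | d i == n]| -> R) j : n' != n ->
    phi (e n' j) (\sum_j y j *: x (@e n j)) = 0.
  move=> nn'; rewrite phi_sum big1 // => l _; case: eqP => [E|_].
    by move: nn'; rewrite -(de n' j) E de eqxx.
  by rewrite mulr0.
have fv : f v = 0.
  by rewrite !linearD !linear_sum !big1 ?addr0 // => j _; rewrite linearZ /= fx scaler0.
have vK : v \in ker_pred f by apply/eqP.
exists (Kernel vK); congr (_, _, _); apply/ffunP => j; rewrite ffunE /= !linearD /=.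
- by rewrite phi_eq !phi_neq // !addr0.
- by rewrite phi_eq !phi_neq // addr0 add0r; exact: quotmod_reprK.
- by rewrite phi_eq !phi_neq // !add0r; exact: quotmod_reprK.
Qed.

End CyclicBasis.

(** * Functoriality in the letters *)

Section FreeModuleTheory.
Variables (R : comNzRingType) (X : finType).

Lemma linear_ext_basis (M : lmodType R) (h : X -> M) x :
  linear_ext h (basis_elt x) = h x.
Proof.
rewrite /linear_ext (bigD1 x) //= ffunE eqxx scale1r big1 ?addr0 // => y yx.
by rewrite ffunE (negPf yx) scale0r.
Qed.

Lemma free_mod_expand (v : free_mod R X) : v = \sum_x (v x : R) *: basis_elt x.
Proof.
apply/ffunP => y; rewrite sum_ffunE (bigD1 y) //= !ffunE eqxx [_ *: _]mulr1.
rewrite big1 ?addr0 // => x xy.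
by rewrite !ffunE eq_sym (negPf xy) [_ *: _]mulr0.
Qed.

Lemma linear_basis_eq (M : lmodType R) (F G : {linear free_mod R X -> M}) :
  (forall x, F (basis_elt x) = G (basis_elt x)) -> F =1 G.
Proof.
move=> FG v; rewrite (free_mod_expand v) !linear_sum; apply: eq_bigr => x _.
by rewrite !linearZ /= FG.
Qed.

End FreeModuleTheory.

Section BasisFormulas.
Variables m n : nat.
Implicit Types t : n.-tuple 'I_m.

Definition swap_tuple t (j : 'I_n.-1) : n.-tuple 'I_m :=
  replace2 t j (tnth t (pos2 j), tnth t (pos1 j)).

Lemma YB_at_basis (j : 'I_n.-1) t :
  YB_at j (basis_elt t) =
    if (tnth t (pos2 j) <= tnth t (pos1 j))%N then basis_elt (swap_tuple t j)
    else (1 - y2) *: basis_elt t + y2 *: basis_elt (swap_tuple t j).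
Proof.
have tE : replace2 t j (tnth t (pos1 j), tnth t (pos2 j)) = t.
  apply: eq_from_tnth => l; rewrite tnth_mktuple /=.
  by case: eqP => [->//|_]; case: eqP => [->|].
rewrite /YB_at /YB linear_ext_basis linear_ext_basis /YB_basis.
case: ifP => _; first by rewrite linear_ext_basis.
by rewrite linearD !linearZ /= !linear_ext_basis tE.
Qed.

Lemma delete_first_basis t :
  delete_first (basis_elt t) = basis_elt (behead_tuple t).
Proof. exact: linear_ext_basis. Qed.

Definition belast_tuple t : n.-1.-tuple 'I_m :=
  [tuple tnth t (widen_ord (leq_pred n) l) | l < n.-1].

Lemma delete_last_basis t :
  delete_last (basis_elt t) = basis_elt (belast_tuple t).
Proof. exact: linear_ext_basis. Qed.

End BasisFormulas.

Section Functoriality.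
Variables (m m' : nat) (h : 'I_m -> 'I_m').

Definition push n : chain m n -> chain m' n :=
  linear_ext (fun t : n.-tuple 'I_m => basis_elt (map_tuple h t) : chain m' n).

HB.instance Definition _ n := GRing.Linear.on (@push n).

Lemma push_basis n (t : n.-tuple 'I_m) :
  push (basis_elt t) = basis_elt (map_tuple h t).
Proof. exact: linear_ext_basis. Qed.

Hypothesis h_mono : {homo h : a b / (a <= b)%N}.

Lemma map_swap_tuple n (t : n.-tuple 'I_m) j :
  map_tuple h (swap_tuple t j) = swap_tuple (map_tuple h t) j.
Proof.
apply: eq_from_tnth => l; rewrite tnth_map !tnth_mktuple /= !tnth_map.
by case: ifP => // _; case: ifP.
Qed.

(** If h merges the two letters of an ascent then both words in the value of the
    operator have the same image, with total coefficient (1 - y2) + y2 = 1. *)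
Lemma push_YB_at n (j : 'I_n.-1) (c : chain m n) :
  push (YB_at j c) = YB_at j (push c).
Proof.
move: c; apply: (@linear_basis_eq _ _ _ (@push n \o @YB_at m n j)
  (@YB_at m' n j \o @push n)) => t /=.
rewrite push_basis !YB_at_basis !tnth_map -map_swap_tuple.
case: (leqP (tnth t (pos2 j)) (tnth t (pos1 j))) => [le21|lt12].
  by rewrite (h_mono le21) push_basis.
rewrite linearD !linearZ /= !push_basis; case: leqP => // hle21.
have heq : h (tnth t (pos2 j)) = h (tnth t (pos1 j)).
  by apply/val_inj/eqP; rewrite eqn_leq hle21 h_mono // ltnW.
have -> : map_tuple h (swap_tuple t j) = map_tuple h t.
  apply: eq_from_tnth => l; rewrite [RHS]tnth_map tnth_map tnth_mktuple /=.
  by case: eqP => [->//|_]; case: eqP => [->|].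
by rewrite -scalerDl subrK scale1r.
Qed.

Lemma push_delete_first n (c : chain m n) :
  push (delete_first c) = delete_first (push c).
Proof.
move: c; apply: (@linear_basis_eq _ _ _ (@push n.-1 \o @delete_first m n)
  (@delete_first m' n \o @push n)) => t /=.
rewrite delete_first_basis !push_basis delete_first_basis; congr basis_elt.
by apply: val_inj; rewrite /= behead_map.
Qed.

Lemma push_delete_last n (c : chain m n) :
  push (delete_last c) = delete_last (push c).
Proof.
move: c; apply: (@linear_basis_eq _ _ _ (@push n.-1 \o @delete_last m n)
  (@delete_last m' n \o @push n)) => t /=.
rewrite delete_last_basis !push_basis delete_last_basis; congr basis_elt.
by apply: eq_from_tnth => l; rewrite tnth_map !tnth_mktuple tnth_map.
Qed.

Lemma push_boundary n (c : chain m n) : push (boundary c) = boundary (push c).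
Proof.
rewrite /boundary linear_sum; apply: eq_bigr => i _.
rewrite linearZ linearB /=; congr (_ *: (_ - _)).
  rewrite /face_l push_delete_first; congr delete_first.
  by elim: [seq j <- _ | _] => //= j s <-; rewrite push_YB_at.
rewrite /face_r push_delete_last; congr delete_last.
by elim: [seq j <- _ | _] c => //= j s IHs c; rewrite IHs push_YB_at.
Qed.

End Functoriality.

Lemma push_comp m m' m'' (h : 'I_m -> 'I_m') (h' : 'I_m' -> 'I_m'') n
    (c : chain m n) : push h' (push h c) = push (h' \o h) c.
Proof.
move: c; apply: (@linear_basis_eq _ _ _ (@push _ _ h' n \o @push _ _ h n)
  (@push _ _ (h' \o h) n)) => t /=.
rewrite !push_basis; congr basis_elt; apply: val_inj => /=.
by rewrite map_comp.
Qed.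

Lemma push_id m (h : 'I_m -> 'I_m) n (c : chain m n) : h =1 id -> push h c = c.
Proof.
move=> h_id; move: c.
apply: (@linear_basis_eq _ _ _ (@push _ _ h n) (@idfun (chain m n))) => t /=.
by rewrite push_basis; congr basis_elt; apply: val_inj; rewrite /= map_id_in.
Qed.

Lemma eq_push m m' (h h' : 'I_m -> 'I_m') n (c : chain m n) :
  h =1 h' -> push h c = push h' c.
Proof. by move=> /funext->. Qed.

(** * Degenerate chains *)

Section Degenerate.
Variable p : nat.

Definition full n (t : n.-tuple 'I_p.+1) : bool :=
  [forall i : 'I_p, lift ord0 i \in t].

(** The letters other than [ord0] are those that a full word must contain; the reduced
    complex is the quotient by the chains below. *)
Definition degenerate n (c : chain p.+1 n) : Prop := forall t, full t -> c t = 0.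

Lemma degenerate_linear_eq0 n (M : lmodType k) (F : {linear chain p.+1 n -> M}) :
  (forall t, ~~ full t -> F (basis_elt t) = 0) ->
  forall c, degenerate c -> F c = 0.
Proof.
move=> F0 c c_deg; rewrite (free_mod_expand c) linear_sum big1 // => t _.
rewrite linearZ /=; have [/c_deg->|/F0->] := boolP (full t).
  by rewrite scale0r.
by rewrite scaler0.
Qed.

Lemma degenerate_image n n' (F : {linear chain p.+1 n -> chain p.+1 n'}) :
  (forall t, ~~ full t -> degenerate (F (basis_elt t))) ->
  forall c, degenerate c -> degenerate (F c).
Proof.
move=> F0 c c_deg s s_full; rewrite (free_mod_expand c) linear_sum sum_ffunE.
rewrite big1 // => t _; rewrite linearZ /= ffunE.
have [/c_deg->|/F0/(_ s s_full)->] := boolP (full t).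
  by rewrite scale0r.
by rewrite scaler0.
Qed.

Lemma push_missing m n (h : 'I_m -> 'I_p.+1) (i : 'I_p) (c : chain m n) :
  (forall a, h a != lift ord0 i) -> degenerate (push h c).
Proof.
move=> hi t /forallP/(_ i) ti; rewrite /push /linear_ext sum_ffunE big1 // => s _.
rewrite !ffunE; case: eqP => [tE|_]; last by rewrite [_ *: _]mulr0.
by move: ti; rewrite tE => /mapP[a _ ai]; case/eqP: (hi a).
Qed.

(** The monotone map that lowers the letter [lift ord0 i] to its predecessor and fixes
    the words that miss this letter. *)
Definition collapse (i : 'I_p) (a : 'I_p.+1) : 'I_p.+1 :=
  if a == lift ord0 i then widen_ord (leqnSn p) i else a.

Lemma collapse_mono i : {homo collapse i : a b / (a <= b)%N}.
Proof.
move=> a b ab; rewrite /collapse -!(inj_eq val_inj) /= /bump /= !add1n.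
case: eqP => [ai|ai]; case: eqP => [bi|bi] //=.
  by rewrite (leq_trans _ ab) // ai.
by move: ab ai; rewrite bi leq_eqVlt ltnS => /orP[/eqP|].
Qed.

Lemma collapse_missing i a : collapse i a != lift ord0 i.
Proof.
rewrite /collapse; case: ifPn => // _.
by rewrite -(inj_eq val_inj) /= /bump /= add1n neq_ltn ltnSn.
Qed.

(** A word that misses a letter is fixed by the collapse of this letter, so its
    boundary is in the image of that collapse, by functoriality. *)
Lemma degenerate_boundary n (c : chain p.+1 n) :
  degenerate c -> degenerate (boundary c).
Proof.
apply: (@degenerate_image _ _ (@boundary p.+1 n)) => t.
rewrite negb_forall => /existsP[i ti] /=.
have -> : basis_elt t = push (collapse i) (basis_elt t) :> chain p.+1 n.
  rewrite push_basis; congr basis_elt; apply: val_inj; rewrite /= map_id_in // => a at_.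
  rewrite /collapse; case: eqP => // aE.
  by rewrite aE (negPf ti) in at_ *.
rewrite -push_boundary; last exact: collapse_mono.
by apply: (@push_missing _ _ _ i) => a; apply: collapse_missing.
Qed.

End Degenerate.

(** The terms of J and of J with i added or removed cancel. *)
Lemma alternating_sum_eq0 (T : finType) (V : lmodType k) (G : {set T} -> V) i :
  (forall J : {set T}, G (i |: J) = G (J :\ i)) ->
  \sum_(J : {set T}) (-1) ^+ #|J| *: G J = 0.
Proof.
move=> Gi; rewrite (bigID (fun J : {set T} => i \in J)) /=.
rewrite (reindex_onto (fun J : {set T} => i |: J) (fun J => J :\ i)) /=; last first.
  by move=> J iJ; rewrite setD1K.
rewrite (eq_bigl (fun J : {set T} => i \notin J)) => [|J]; last first.
  rewrite setU11 /=; apply/eqP/idP => [<-|iJ]; first by rewrite setD11.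
  by rewrite setU1K.
rewrite -big_split big1 //= => J iJ; rewrite cardsU1 iJ exprS mulN1r scaleNr.
by rewrite Gi (setDidPl _) ?addNr // disjoint_sym disjoints1.
Qed.

(** * Splitting along sets of letters *)

Lemma count_lt_nth_sorted (x0 : nat) (s : seq nat) i :
  sorted ltn s -> (i < size s)%N -> count (fun y => (y < nth x0 s i)%N) s = i.
Proof.
elim: s i => //= x s IHs i xs; have s_sorted := path_sorted xs.
have x_lt : all (fun y => (x < y)%N) s by exact: order_path_min ltn_trans xs.
case: i => [_|i is_]; rewrite /= ?ltnn.
  rewrite add0n; apply/eqP; rewrite -leqn0 leqNgt -has_count; apply/hasPn => y ys.
  by rewrite -leqNgt ltnW // (allP x_lt).
by rewrite IHs // (allP x_lt) ?mem_nth.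
Qed.

Section SubsetLetters.
Variables (q : nat) (S : {set 'I_q}).
Notation p := #|S|.

Lemma card_lt_enum_val (i : 'I_p) : #|[set s in S | (s < enum_val i)%N]| = i.
Proof.
have Ep : (i < size (enum S))%N by rewrite -cardE.
transitivity (count (fun y => (y < nth (val (enum_val i)) (map val (enum S)) i)%N)
               (map val (enum S))); last first.
  apply: count_lt_nth_sorted; last by rewrite size_map.
  apply: (subseq_sorted ltn_trans _ (iota_ltn_sorted 0 q)).
  by rewrite -val_enum_ord map_subseq // [X in subseq _ X]enumT filter_subseq.
rewrite (nth_map (enum_val i)) // count_map cardE -size_filter.
apply/perm_size/uniq_perm; rewrite ?(filter_uniq, enum_uniq) // => s.
by rewrite mem_enum [RHS]mem_filter mem_enum !inE /= -enum_val_nth andbC.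
Qed.

Lemma card_le_enum_val (i : 'I_p) : #|[set s in S | (s <= enum_val i)%N]| = i.+1.
Proof.
rewrite -[in RHS]card_lt_enum_val.
have -> : [set s in S | (s <= enum_val i)%N]
        = enum_val i |: [set s in S | (s < enum_val i)%N].
  apply/setP => s; rewrite !inE leq_eqVlt andb_orr (inj_eq val_inj).
  by case: eqP => [->|_]; rewrite ?enum_valP ?andbF.
by rewrite cardsU1 !inE ltnn andbF.
Qed.

(** Lowers a letter x to the greatest one below or equal to x that is [ord0] or comes from
    S, and replaces the latter by its rank. An element s of S stands for the letter
    [lift ord0 s]. *)
Definition rank_in (x : 'I_q.+1) : 'I_p.+1 := inord #|[set s in S | (s < x)%N]|.

Lemma val_rank_in x : rank_in x = #|[set s in S | (s < x)%N]| :> nat.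
Proof.
rewrite inordK // ltnS subset_leq_card //.
by apply/subsetP => s; rewrite inE => /andP[].
Qed.

Lemma rank_in_mono : {homo rank_in : x y / (x <= y)%N}.
Proof.
move=> x y xy; rewrite !val_rank_in subset_leq_card //.
by apply/subsetP => s; rewrite !inE => /andP[-> /leq_trans->].
Qed.

(** For J = set0 this is the increasing enumeration of [ord0] and the letters of S; the
    letters numbered in J are lowered by one, to the preceding letter of the whole
    alphabet, which need not belong to S. *)
Definition section_of (J : {set 'I_p}) (a : 'I_p.+1) : 'I_q.+1 :=
  if unlift ord0 a is Some i then
    if i \in J then widen_ord (leqnSn q) (enum_val i) else lift ord0 (enum_val i)
  else ord0.

Lemma section_of0 J : section_of J ord0 = ord0.
Proof. by rewrite /section_of unlift_none. Qed.

Lemma section_of_lift J i : section_of J (lift ord0 i) =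
  if i \in J then widen_ord (leqnSn q) (enum_val i) else lift ord0 (enum_val i).
Proof. by rewrite /section_of liftK. Qed.

Lemma enum_val_ltn (i j : 'I_p) : (i < j)%N -> (enum_val i < enum_val j)%N.
Proof.
move=> ij; rewrite ltnNge; apply: contraL ij => ji.
rewrite -leqNgt -[X in (X <= _)%N]card_lt_enum_val -[X in (_ <= X)%N]card_lt_enum_val.
by apply/subset_leq_card/subsetP => s; rewrite !inE => /andP[-> /leq_trans->].
Qed.

Lemma section_of_mono J : {homo section_of J : a b / (a <= b)%N}.
Proof.
move=> a b; case: (unliftP ord0 a) => [i|] ->; last by rewrite section_of0.
case: (unliftP ord0 b) => [j|] ->; last by [].
rewrite !section_of_lift /= /bump !add1n ltnS leq_eqVlt => /orP[/eqP/val_inj->//|ij].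
have := enum_val_ltn ij; by case: (i \in J); case: (j \in J); rewrite /= /bump /=; lia.
Qed.

Lemma rank_section J (i : 'I_p) :
  rank_in (section_of J (lift ord0 i)) = (i + (i \notin J))%N :> nat.
Proof.
rewrite section_of_lift val_rank_in; case: ifP => _ /=.
  by rewrite card_lt_enum_val addn0.
rewrite addn1 -[RHS]card_le_enum_val; apply: eq_card => s.
by rewrite !inE /= /bump add1n ltnS.
Qed.

Lemma rank_section0 J : rank_in (section_of J ord0) = ord0.
Proof.
apply: val_inj; rewrite /= section_of0 val_rank_in /=.
by apply: eq_card0 => s; rewrite !inE andbF.
Qed.

(** The alternating sum makes [spread] vanish on degenerate chains, so that it is a
    chain map from the reduced complex. Lowering to the preceding letter of the whole
    alphabet, and not of S, is what makes the composite with [rank_in S'] zero, and not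
    just triangular, for S' <> S. *)
Definition spread n (c : chain p.+1 n) : chain q.+1 n :=
  \sum_(J : {set 'I_p}) (-1) ^+ #|J| *: push (section_of J) c.

Lemma spread_is_linear n : linear (@spread n).
Proof.
move=> a u v; rewrite /spread scaler_sumr -big_split /=; apply: eq_bigr => J _.
by rewrite linearP scalerDr !scalerA mulrC.
Qed.

HB.instance Definition _ n :=
  GRing.isLinear.Build k (chain p.+1 n) (chain q.+1 n) *:%R (@spread n)
    (@spread_is_linear n).

Lemma boundary_spread n (c : chain p.+1 n) :
  boundary (spread c) = spread (boundary c).
Proof.
rewrite /spread linear_sum; apply: eq_bigr => J _.
by rewrite linearZ push_boundary //; apply: section_of_mono.
Qed.

(** If the letter numbered i is missing, then it does not matter whether i is in J. *)
Lemma spread_degenerate n (c : chain p.+1 n) : degenerate c -> spread c = 0.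
Proof.
move: c; apply: degenerate_linear_eq0 => t; rewrite negb_forall => /existsP[i ti].
apply: (alternating_sum_eq0 (i := i)) => J.
rewrite !push_basis; congr basis_elt; apply: val_inj => /=.
apply/eq_in_map => a at_; case: (unliftP ord0 a) => [j|] aE; last first.
  by rewrite aE !section_of0.
have ji : j != i by apply: contraNneq ti => <-; rewrite -aE.
by rewrite aE !section_of_lift !inE (negPf ji).
Qed.

(** The term J = set0 is the identity. In every other term the letter numbered by the
    largest element of J is lowered while the next one is not, so that it is missing
    from the words of the image. *)
Lemma rank_spread_same n (c : chain p.+1 n) : degenerate (push rank_in (spread c) - c).
Proof.
rewrite /spread (bigD1 set0) //= linearD /= cards0 scale1r push_comp.
rewrite push_id; last first.
  move=> a /=; case: (unliftP ord0 a) => [i|] ->; last by rewrite rank_section0.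
  by apply: val_inj; rewrite /= rank_section inE /bump addn1 add1n.
rewrite addrC addKr => t t_full; rewrite linear_sum sum_ffunE big1 // => J J0.
rewrite linearZ /= push_comp ffunE [X in _ *: X](_ : _ = 0) ?scaler0 //.
have [i0 i0J] := set0Pn _ J0.
case: (arg_maxnP (fun i : 'I_p => val i) i0J) => i iJ i_max.
apply: (push_missing (i := i)) t_full => a /=.
case: (unliftP ord0 a) => [j|] ->; last by rewrite rank_section0.
rewrite -(inj_eq val_inj) /= rank_section /bump leq0n add1n; apply/eqP.
have [jJ|jJ] := boolP (j \in J); first by have := i_max _ jJ; rewrite /=; lia.
by rewrite addn1 => -[/val_inj ji]; rewrite ji (iJ : i \in J) in jJ.
Qed.

End SubsetLetters.

(** If S has a letter s outside S', then [rank_in S'] does not separate s from its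
    predecessor, and the alternating sum cancels; otherwise S has too few letters for
    the words of the image to be full on S'. *)
Lemma rank_spread_diff q (S S' : {set 'I_q}) n (c : chain #|S|.+1 n) :
  S' != S -> degenerate (push (rank_in S') (spread c)).
Proof.
move=> S'S; have [SS'|] := boolP (S \subset S'); last first.
  case/subsetPn => s sS sS'; rewrite /spread linear_sum /=.
  under eq_bigr => J _ do rewrite linearZ /= push_comp.
  rewrite (alternating_sum_eq0 (i := enum_rank_in sS s)) => [t _|J].
    by rewrite ffunE.
  apply: eq_push => a /=.
  case: (unliftP ord0 a) => [j|] ->; last by rewrite !section_of0.
  rewrite !section_of_lift !inE; case: eqP => //= ->; rewrite enum_rankK_in //.
  apply: val_inj; rewrite /= !val_rank_in /=; apply: eq_card => s'.
  rewrite !inE /= /bump add1n ltnS [in RHS]leq_eqVlt andb_orr.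
  by case: eqP => [/ord_inj->|_]; rewrite ?andbF // (negPf sS').
have pp' : (#|S| < #|S'|)%N by rewrite proper_card // properEneq eq_sym S'S.
rewrite /spread linear_sum => t t_full; rewrite sum_ffunE big1 // => J _.
rewrite linearZ /= push_comp ffunE [X in _ *: X](_ : _ = 0) ?scaler0 //.
set h := _ \o _; have h0 : h ord0 = ord0.
  apply: val_inj; rewrite /h /= section_of0 val_rank_in.
  by apply: eq_card0 => s; rewrite !inE andbF.
have /subsetPn[a _ ah] : ~~ ([set: 'I_#|S'|.+1] \subset h @: setT).
  apply: contraL pp' => /subset_leq_card; rewrite cardsT card_ord -leqNgt => H.
  by rewrite -ltnS (leq_trans H) // (leq_trans (leq_imset_card _ _)) // cardsT card_ord.
case: (unliftP ord0 a) ah => [i|] -> ah; last by rewrite -h0 imset_f in ah.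
apply: (push_missing (i := i)) t_full => b.
by apply: contraNneq ah => <-; rewrite imset_f.
Qed.

(** Let t be a word of v of maximal sum and S the set of its letters. Any other
    word with the same image as t under [rank_in S] is above t letter by letter,
    so it has a larger sum and is not in v: the coefficient of t survives. *)
Lemma degenerate_rank_inj q n (v : chain q.+1 n) :
  (forall S : {set 'I_q}, degenerate (push (rank_in S) v)) -> v = 0.
Proof.
move=> v_deg; apply/eqP/contraT => v_neq0.
have [t0 t0v] : exists t, v t != 0.
  apply: contrapT => v0; case/negP: v_neq0; apply/eqP/ffunP => t; rewrite ffunE.
  by apply/eqP/contraT => vt; case: v0; exists t.
pose weight (t : n.-tuple 'I_q.+1) := (\sum_l tnth t l)%N.
case: (arg_maxnP (P := fun t => v t != 0) weight t0v) => t vt t_max.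
pose S := [set i : 'I_q | lift ord0 i \in t].
have Sfull : full (map_tuple (rank_in S) t).
  apply/forallP => i; apply/mapP; exists (lift ord0 (enum_val i)).
    by have := enum_valP i; rewrite inE.
  apply: val_inj; rewrite /= val_rank_in /= /bump !add1n -[LHS]card_le_enum_val.
  by apply: eq_card => s; rewrite !inE.
have := v_deg S _ Sfull; rewrite /push /linear_ext sum_ffunE (bigD1 t) //= !ffunE eqxx.
rewrite big1 => [|s st].
  by rewrite addr0 [_ *: _]mulr1 => /eqP; rewrite (negPf vt).
rewrite !ffunE; case: eqP => [ts|_]; last by rewrite [_ *: _]mulr0.
have le_ts l : (tnth t l <= tnth s l)%N.
  have /(congr1 (fun w => val (tnth w l))) := ts; rewrite !tnth_map.
  rewrite /= !val_rank_in => cardE; rewrite leqNgt; apply/negP => lt_st.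
  case: (unliftP ord0 (tnth t l)) lt_st cardE => [i|] tl; rewrite tl //= => lt_st.
  have iS : i \in S by rewrite inE -tl mem_tnth.
  move=> cardE; have : (#|[set s' in S | (s' < tnth s l)%N]|
                        < #|[set s' in S | (s' < bump 0 i)%N]|)%N.
    apply/proper_card/properP; split.
      by apply/subsetP => s'; rewrite !inE => /andP[-> /= /ltn_trans->].
    by exists i; rewrite inE iS /= ?lt_st // -leqNgt; move: lt_st; rewrite /bump.
  by rewrite cardE ltnn.
have [/eqP->|vs] := boolP (v s == 0); first by rewrite scale0r.
case/eqP: st; apply/eq_from_tnth => l; apply: val_inj; apply/eqP.
have [// | ne] := altP (_ =P _).
have /= := t_max s vs; rewrite /geq /= leqNgt => /negP[]; rewrite /weight.
rewrite (bigD1 l) //= [X in (_ < X)%N](bigD1 l) //=.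
rewrite -addSn leq_add //; last by apply: leq_sum.
by rewrite ltn_neqAle eq_sym ne le_ts.
Qed.

Section Gluing.
Variables (n : nat) (delta : nat -> k).

(** [cyclic_basis] for the reduced complex on p + 1 letters, in degree n, written with
    chains that represent elements of the quotient by degenerate chains. *)
Definition is_reduced_basis (p N : nat) (d : 'I_N -> nat)
    (x : 'I_N -> chain p.+1 n) (phi : 'I_N -> {linear chain p.+1 n -> k^o}) : Prop :=
    [/\ forall i c, degenerate c -> phi i c = 0,
        forall i, degenerate (boundary (x i)),
        forall i j, phi i (x j) = (i == j)%:R,
        forall v, degenerate (boundary v) -> (forall i, phi i v = 0) -> degenerate v
      & (forall i, exists u : chain p.+1 n.+1,
           degenerate (boundary u - delta (d i) *: x i : chain p.+1 n)) /\
        (forall i (u : chain p.+1 n.+1),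
           exists r, phi i (boundary u) = r * delta (d i))].

Definition reduced_cyclic_basis (p N : nat) (d : 'I_N -> nat) : Prop :=
  exists x phi, @is_reduced_basis p N d x phi.

Variables (N : nat -> nat) (d : forall p, 'I_(N p) -> nat).
Hypothesis reduced : forall p, reduced_cyclic_basis p (@d p).

(** The bases of the summands are carried over by [spread] and their coordinates
    by [push (rank_in S)]. *)
Lemma cyclic_basis_of_reduced q :
  @cyclic_basis k (chain q.+1 n.+1) (chain q.+1 n) (chain q.+1 n.-1)
    (@boundary q.+1 n) (@boundary q.+1 n.+1)
    {S : {set 'I_q} & 'I_(N #|S|)} (fun s => delta (d (tagged s))).
Proof.
pose x p := sval (cid (reduced p)).
pose phi p := sval (cid (svalP (cid (reduced p)))).
have H p : is_reduced_basis (@d p) (x p) (phi p) :=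
  svalP (cid (svalP (cid (reduced p)))).
pose X (s : {S : {set 'I_q} & 'I_(N #|S|)}) := spread (x #|tag s| (tagged s)).
pose Phi (s : {S : {set 'I_q} & 'I_(N #|S|)}) : {linear chain q.+1 n -> k^o} :=
  phi #|tag s| (tagged s) \o @push _ _ (rank_in (tag s)) n.
exists X, Phi; split.
- move=> [S i]; rewrite /X /= boundary_spread.
  by apply: spread_degenerate; have [_ bx _ _ _] := H #|S|; apply: bx.
- move=> [S' i] [S j]; rewrite /Phi /X /=.
  have [phi0 _ phix _ _] := H #|S'|.
  have [SS'|S'S] := altP (S' =P S).
    case: S / SS' j => j.
    have /eqP := phi0 i _ (rank_spread_same (x #|S'| j)).
    by rewrite linearB subr_eq0 phix eq_Tagged /= => /eqP->.
  rewrite (phi0 i); last exact: rank_spread_diff.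
  case: eqP => // /(congr1 tag) /= SS'; by rewrite SS' eqxx in S'S.
- move=> v bv Phiv; apply: degenerate_rank_inj => S.
  have [_ _ _ phi_inj _] := H #|S|; apply: phi_inj => [|i].
    rewrite -push_boundary; last exact: rank_in_mono.
    by rewrite bv => t _; rewrite linear0 ffunE.
  exact: Phiv (Tagged (fun S : {set 'I_q} => 'I_(N #|S|)) i).
- move=> [S i]; have [_ _ _ _ [/(_ i)[u hu] _]] := H #|S|.
  exists (spread u); rewrite /= boundary_spread /X /=; apply/eqP.
  by rewrite -linearZ -subr_eq0 -linearB /= (spread_degenerate hu).
- move=> [S i] u; rewrite /Phi /= (@push_boundary _ _ _ (@rank_in_mono _ S) n.+1 u).
  by have [_ _ _ _ [_]] := H #|S|; apply.
Qed.

End Gluing.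

Lemma sum_card_subsets q (f : nat -> nat) n :
  (forall p, (n <= p)%N -> f p = 0%N) ->
  (\sum_(S : {set 'I_q}) f #|S| = \sum_(p < n) 'C(q, p) * f p)%N.
Proof.
move=> f0; pose F p := ('C(q, p) * f p)%N.
transitivity (\sum_(p < q.+1) F p)%N.
  rewrite (partition_big (fun S : {set 'I_q} => inord #|S| : 'I_q.+1) predT) //=.
  apply: eq_bigr => p _.
  have cp (S : {set 'I_q}) : (inord #|S| == p) = (#|S| == p).
    by rewrite -(inj_eq val_inj) /= inordK // ltnS -[X in (_ <= X)%N]card_ord max_card.
  rewrite (eq_bigl _ _ cp) (eq_bigr (fun _ => f p)) => [|S /eqP-> //].
  rewrite sum_nat_const /F; congr (_ * _)%N.
  have := card_draws 'I_q p; rewrite card_ord => <-.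
  by apply: eq_card => S; rewrite !inE.
transitivity (\sum_(p < maxn n q.+1) F p)%N.
  rewrite (big_ord_widen _ F (leq_maxr n q.+1)) big_mkcond; apply: eq_bigr => p _.
  by case: ltnP => // qp; rewrite /F bin_small.
rewrite [RHS](big_ord_widen _ F (leq_maxl n q.+1)) [RHS]big_mkcond.
apply: eq_bigr => p _.
by case: ltnP => // np; rewrite /F f0 ?muln0.
Qed.

Lemma card_tagged_pred (I : finType) (J : I -> finType) (P : forall i, pred (J i)) :
  #|[pred s : {i : I & J i} | P (tag s) (tagged s)]| = (\sum_i #|P i|)%N.
Proof.
rewrite -sum1_card -(sig_big_dep (fun _ => true) P (fun _ _ => 1%N)) /=.
by apply: eq_bigr => i _; rewrite sum1_card.
Qed.

(** * Computing with sparse chains *)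

Section CoefLists.
Implicit Types a b : seq int.

(** The coefficient list a stands for the polynomial [Poly a]; trailing zeros are
    allowed. *)
Fixpoint add_coefs a b : seq int :=
  match a, b with
  | x :: a', y :: b' => x + y :: add_coefs a' b'
  | [::], _ => b
  | _, [::] => a
  end.

Definition opp_coefs a : seq int := map -%R a.

Definition mulX_coefs a : seq int := 0 :: a.

Fixpoint mul_coefs a b : seq int :=
  if a is x :: a' then add_coefs (map ( *%R x) b) (mulX_coefs (mul_coefs a' b))
  else [::].

Definition zero_coefs a : bool := all (pred1 0) a.

Lemma Poly_cons x a : Poly (x :: a) = x%:P + 'X * Poly a.
Proof. by rewrite /= cons_poly_def addrC mulrC. Qed.

Lemma Poly_add a b : Poly (add_coefs a b) = Poly a + Poly b.
Proof.
elim: a b => [|x a IHa] [|y b]; rewrite ?add0r ?addr0 //.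
by rewrite [add_coefs _ _]/= !Poly_cons IHa mulrDr polyCD addrACA.
Qed.

Lemma Poly_opp a : Poly (opp_coefs a) = - Poly a.
Proof.
elim: a => [|x a IHa]; first by rewrite oppr0.
by rewrite [opp_coefs _]/= !Poly_cons IHa mulrN polyCN opprD.
Qed.

Lemma Poly_mulX a : Poly (mulX_coefs a) = 'X * Poly a.
Proof. by rewrite Poly_cons add0r. Qed.

Lemma Poly_mul a b : Poly (mul_coefs a b) = Poly a * Poly b.
Proof.
have Poly_scale x : Poly (map ( *%R x) b) = x%:P * Poly b.
  elim: b => [|y b IHb]; first by rewrite mulr0.
  by rewrite [map _ _]/= !Poly_cons IHb polyCM mulrDr mulrCA.
elim: a => [|x a IHa]; first by rewrite mul0r.
by rewrite [mul_coefs _ _]/= Poly_add Poly_mulX IHa Poly_scale Poly_cons mulrDl mulrA.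
Qed.

Lemma zero_coefsE a : zero_coefs a = (Poly a == 0).
Proof.
apply/idP/eqP => [|a0].
  elim: a => //= x a IHa /andP[/eqP-> /IHa a0].
  by rewrite cons_poly_def a0 mul0r add0r.
apply/(all_nthP 0) => i _ /=.
by rewrite -[nth _ _ _]/(a`_i) -coef_Poly a0 coef0.
Qed.

(** Division by 1 - 'X^d, with quotient q given by q_i = a_i + q_(i - d): carry holds
    the last d coefficients of q, and the quotient is cut at the length of a. *)
Fixpoint quo_coefs (carry : seq int) a : seq int :=
  if a is x :: a' then
    let y := x + head 0 carry in y :: quo_coefs (rcons (behead carry) y) a'
  else [::].

Definition oneBX (d : nat) : seq int := add_coefs [:: 1] (opp_coefs (ncons d 0 [:: 1])).

Definition quo_oneBX (d : nat) a : seq int :=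
  if d is 0 then [::] else quo_coefs (nseq d 0) a.

Definition dvd_oneBX (d : nat) a : bool :=
  zero_coefs (add_coefs a (opp_coefs (mul_coefs (quo_oneBX d a) (oneBX d)))).

Lemma Poly_oneBX d : Poly (oneBX d) = 1 - 'X ^+ d.
Proof.
rewrite Poly_add Poly_opp; congr (_ - _).
  by rewrite Poly_cons mulr0 addr0.
elim: d => [|d IHd]; first by rewrite Poly_cons mulr0 addr0.
by rewrite -[ncons _ _ _]/(mulX_coefs (ncons d 0 [:: 1])) Poly_mulX IHd exprS.
Qed.

Lemma dvd_oneBXP d a : dvd_oneBX d a -> exists r, Poly a = r * (1 - 'X ^+ d).
Proof.
rewrite /dvd_oneBX zero_coefsE Poly_add Poly_opp Poly_mul Poly_oneBX subr_eq0.
by move/eqP->; exists (Poly (quo_oneBX d a)).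
Qed.

End CoefLists.

Arguments add_coefs : simpl never.
Arguments opp_coefs : simpl never.
Arguments mulX_coefs : simpl never.
Arguments mul_coefs : simpl never.

Definition word := seq nat.
(** Lists of terms, in which a word may occur several times. *)
Definition sparse := seq (seq int * word).

Fixpoint coef_at (l : sparse) (w : word) : seq int :=
  if l is (c, v) :: l' then
    if v == w then add_coefs c (coef_at l' w) else coef_at l' w
  else [::].

Fixpoint insert_term (c : seq int) (v : word) (l : sparse) : sparse :=
  if l is (c', v') :: l' then
    if v' == v then
      let c2 := add_coefs c c' in if zero_coefs c2 then l' else (c2, v) :: l'
    else (c', v') :: insert_term c v l'
  else [:: (c, v)].

Definition collect (l : sparse) : sparse :=
  foldr (fun e => insert_term e.1 e.2) [::] l.

Definition scale_sparse (c : seq int) (l : sparse) : sparse :=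
  [seq (mul_coefs c e.1, e.2) | e <- l].

Lemma coef_at_cat l l' w :
  Poly (coef_at (l ++ l') w) = Poly (coef_at l w) + Poly (coef_at l' w).
Proof.
elim: l => [|[c v] l IHl] /=; first by rewrite add0r.
by case: eqP => _; rewrite ?Poly_add IHl ?addrA.
Qed.

Lemma coef_at_insert c v l w :
  Poly (coef_at (insert_term c v l) w) = Poly (coef_at ((c, v) :: l) w).
Proof.
elim: l => [|[c' v'] l IHl] //=.
have [->|v'v] := altP (v' =P v); last first.
  rewrite /=; case: eqP => [v'w|_]; last by rewrite IHl.
  rewrite Poly_add IHl /=; case: eqP => [vw|_]; last by rewrite Poly_add.
  by rewrite v'w vw eqxx in v'v.
case: ifP => [|_] /=; last by case: eqP => // _; rewrite !Poly_add addrA.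
rewrite zero_coefsE Poly_add => /eqP c0; case: eqP => // _.
by rewrite !Poly_add addrA c0 add0r.
Qed.

Lemma coef_at_collect l w : Poly (coef_at (collect l) w) = Poly (coef_at l w).
Proof.
elim: l => [|[c v] l IHl] //=; rewrite coef_at_insert /=.
by case: eqP => _; rewrite ?Poly_add IHl.
Qed.

Lemma coef_at_scale c l w :
  Poly (coef_at (scale_sparse c l) w) = Poly c * Poly (coef_at l w).
Proof.
elim: l => [|[c' v] l IHl] /=; first by rewrite mulr0.
by case: eqP => _; rewrite ?Poly_add IHl ?Poly_mul ?mulrDr.
Qed.

Definition YB_sparse (j : nat) (l : sparse) : sparse :=
  flatten
    [seq let s := [seq nth 0%N e.2 (if i == j then j.+1 else if i == j.+1 then j else i)
                    | i <- iota 0 (size e.2)] in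
         if (nth 0 e.2 j.+1 <= nth 0 e.2 j)%N then [:: (e.1, s)]
         else [:: (add_coefs e.1 (opp_coefs (mulX_coefs e.1)), e.2);
                  (mulX_coefs e.1, s)]
       | e <- l].

Definition face_l_sparse n i (l : sparse) : sparse :=
  [seq (e.1, behead e.2) | e <- foldr YB_sparse l [seq j <- iota 0 n.-1 | (j < i)%N]].

Definition face_r_sparse n i (l : sparse) : sparse :=
  [seq (e.1, take n.-1 e.2) |
     e <- foldl (fun l' j => YB_sparse j l') l [seq j <- iota 0 n.-1 | (i <= j)%N]].

Definition boundary_sparse n (l : sparse) : sparse :=
  collect (flatten [seq scale_sparse (if odd i then [:: 1] else [:: -1])
    (face_l_sparse n i l ++ scale_sparse [:: -1] (face_r_sparse n i l))
    | i <- iota 0 n]).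

Section Denotation.
Variable p : nat.

Definition letters n (t : n.-tuple 'I_p.+1) : word := [seq val a | a <- t].

Lemma letters_inj n : injective (@letters n).
Proof. by move=> s t /(inj_map val_inj)/val_inj. Qed.

Lemma size_letters n (t : n.-tuple 'I_p.+1) : size (letters t) = n.
Proof. by rewrite size_map size_tuple. Qed.

Lemma nth_letters n (t : n.-tuple 'I_p.+1) (i : 'I_n) :
  nth 0%N (letters t) i = tnth t i.
Proof. by rewrite (nth_map (tnth t i)) ?size_tuple // -tnth_nth. Qed.

Definition denote n (l : sparse) : chain p.+1 n :=
  [ffun t => Poly (coef_at l (letters t)) : k^o].

Lemma denote_nil n : denote n [::] = 0.
Proof. by apply/ffunP => t; rewrite !ffunE. Qed.

Lemma denote_cat n l l' : denote n (l ++ l') = denote n l + denote n l'.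
Proof. by apply/ffunP => t; rewrite !ffunE coef_at_cat. Qed.

Lemma denote_scale n c l : denote n (scale_sparse c l) = Poly c *: denote n l.
Proof. by apply/ffunP => t; rewrite !ffunE coef_at_scale. Qed.

Lemma denote_collect n l : denote n (collect l) = denote n l.
Proof. by apply/ffunP => t; rewrite !ffunE coef_at_collect. Qed.

Lemma denote1 n c (t : n.-tuple 'I_p.+1) :
  denote n [:: (c, letters t)] = Poly c *: basis_elt t.
Proof.
apply/ffunP => s; rewrite !ffunE /= (inj_eq (@letters_inj n)) eq_sym.
by case: eqP => _; rewrite ?Poly_add ?addr0 [_ *: _]mulr_natr ?mulr1n ?mulr0n.
Qed.

Definition is_word n (w : word) : bool := (size w == n) && all (fun a => a < p.+1)%N w.
Definition are_words n (l : sparse) : bool := all (fun e => is_word n e.2) l.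

Lemma is_wordP n w : reflect (exists t : n.-tuple 'I_p.+1, w = letters t) (is_word n w).
Proof.
apply: (iffP andP) => [[/eqP sw w_lt]|[t ->]].
  have sw' : size [seq inord a : 'I_p.+1 | a <- w] == n by rewrite size_map sw.
  exists (Tuple sw'); rewrite /letters /= -map_comp -[LHS]map_id; apply/eq_in_map.
  by move=> a aw /=; rewrite inordK // (allP w_lt).
by rewrite size_letters eqxx; split=> //; apply/allP => _ /mapP[a _ ->]; apply: ltn_ord.
Qed.

(** Only lists of proper words are considered, since [denote] ignores the terms
    whose word has a wrong length or letter, but f may turn them into proper ones. *)
Definition represents n n' (F : chain p.+1 n -> chain p.+1 n')
    (f : sparse -> sparse) : Prop :=
  forall l, are_words n l -> are_words n' (f l) /\ denote n' (f l) = F (denote n l).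

Lemma represents_flatten n n' (F : {linear chain p.+1 n -> chain p.+1 n'})
    (f : seq int * word -> sparse) :
  (forall c t, are_words n' (f (c, letters t)) /\
     denote n' (f (c, letters t)) = Poly c *: F (basis_elt t)) ->
  represents F (fun l => flatten (map f l)).
Proof.
move=> fF; elim=> [|[c w] l IHl] /=; first by rewrite !denote_nil linear0.
case/andP => /is_wordP[t ->] /IHl[wl El]; have [wf Ef] := fF c t.
rewrite /are_words all_cat in wf wl *; rewrite wf; split => //.
by rewrite denote_cat Ef El -cat1s denote_cat linearD denote1 linearZ.
Qed.

Lemma represents_map n n' (F : {linear chain p.+1 n -> chain p.+1 n'})
    (f : word -> word) (g : n.-tuple 'I_p.+1 -> n'.-tuple 'I_p.+1) :
  (forall t, F (basis_elt t) = basis_elt (g t)) ->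
  (forall t, f (letters t) = letters (g t)) ->
  represents F (fun l => [seq (e.1, f e.2) | e <- l]).
Proof.
move=> Fg fg l wl; rewrite -[map _ l]flatten_map1.
apply: (@represents_flatten _ _ F (fun e => [:: (e.1, f e.2)])) wl => c t /=.
rewrite fg denote1 Fg; split => //; rewrite andbT.
by apply/is_wordP; exists (g t).
Qed.

Lemma represents_YB n (j : 'I_n.-1) : represents (@YB_at p.+1 n j) (YB_sparse j).
Proof.
apply: (represents_flatten (F := @YB_at p.+1 n j)) => c t; rewrite /= size_letters.
have -> : [seq nth 0%N (letters t)
             (if i == val j then j.+1 else if i == j.+1 then val j else i)
           | i <- iota 0 n] = letters (swap_tuple t j).
  apply: (@eq_from_nth _ 0%N) => [|i]; rewrite size_map size_iota ?size_letters //.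
  move=> ilt.
  rewrite (nth_map 0%N) ?size_iota // nth_iota // add0n -[i]/(val (Ordinal ilt)).
  rewrite nth_letters tnth_mktuple /= -!(inj_eq val_inj) /=.
  rewrite -[j.+1](val_pos2 j).
  rewrite -[X in if i == X then _ else if _ then X else _]/(val (pos1 j)).
  case: ifP => _; first by rewrite nth_letters.
  by case: ifP => _; rewrite ?nth_letters // -[i]/(val (Ordinal ilt)) nth_letters.
have E1 : nth 0%N (letters t) j = tnth t (pos1 j) := nth_letters t (pos1 j).
have E2 : nth 0%N (letters t) j.+1 = tnth t (pos2 j) by rewrite -nth_letters val_pos2.
rewrite E1 E2 YB_at_basis.
have ws : is_word n (letters (swap_tuple t j)).
  by apply/is_wordP; exists (swap_tuple t j).
have wt : is_word n (letters t) by apply/is_wordP; exists t.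
case: ifP => _; rewrite /are_words /= ws ?wt ?denote1; split => //.
rewrite -cat1s denote_cat !denote1 Poly_add Poly_opp Poly_mulX scalerDr !scalerA.
by rewrite mulrBr mulr1 (mulrC 'X).
Qed.

Lemma represents_comp n n' n'' (F : chain p.+1 n -> chain p.+1 n')
    (G : chain p.+1 n' -> chain p.+1 n'') f g :
  represents F f -> represents G g -> represents (G \o F) (g \o f).
Proof.
by move=> Ff Gg l /Ff[wf Ef]; have [wg Eg] := Gg _ wf; split; rewrite //= Eg Ef.
Qed.

Lemma filter_iota_ord n (P : pred nat) :
  [seq j <- iota 0 n | P j] = map val [seq j : 'I_n <- enum 'I_n | P j].
Proof. by rewrite -val_enum_ord filter_map. Qed.

Lemma represents_face_l n (i : 'I_n) :
  represents (@face_l p.+1 n i) (face_l_sparse n i).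
Proof.
apply: (@represents_comp _ _ _ (fun c => foldr (@YB_at p.+1 n) c _)
  (@delete_first p.+1 n) (fun l => foldr YB_sparse l _) (map (fun e => (e.1, behead e.2)))).
  rewrite filter_iota_ord; elim: [seq j <- _ | _] => [|j s IHs] //=.
  exact: (represents_comp IHs (represents_YB j)).
apply: (represents_map (F := @delete_first p.+1 n)) => t.
  exact: delete_first_basis.
by rewrite /letters /= behead_map.
Qed.

Lemma represents_face_r n (i : 'I_n) :
  represents (@face_r p.+1 n i) (face_r_sparse n i).
Proof.
apply: (@represents_comp _ _ _ (fun c => foldl (fun c' j => @YB_at p.+1 n j c') c _)
  (@delete_last p.+1 n) (fun l => foldl (fun l' j => YB_sparse j l') l _)
  (map (fun e => (e.1, take n.-1 e.2)))).
  rewrite filter_iota_ord; elim: [seq j <- _ | _] => [|j s IHs] //=.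
  exact: (represents_comp (represents_YB j) IHs).
apply: (represents_map (F := @delete_last p.+1 n)) => t.
  exact: delete_last_basis.
apply: (@eq_from_nth _ 0%N); rewrite size_takel ?size_letters ?leq_pred // => j jn.
rewrite nth_take // -[j in RHS]/(val (Ordinal jn)) nth_letters tnth_mktuple.
by rewrite -nth_letters.
Qed.

Lemma are_words_scale n c l : are_words n (scale_sparse c l) = are_words n l.
Proof. by rewrite /are_words all_map. Qed.

Lemma are_words_cat n l l' : are_words n (l ++ l') = are_words n l && are_words n l'.
Proof. exact: all_cat. Qed.

Lemma are_words_insert n c v l :
  is_word n v -> are_words n l -> are_words n (insert_term c v l).
Proof.
move=> wv; elim: l => [|[c' v'] l IHl] /=; first by rewrite /are_words /= wv.
case/andP=> wv' wl; case: eqP => _ /=; last by rewrite /are_words /= wv'; apply: IHl.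
by case: ifP => _ //=; rewrite /are_words /= wv.
Qed.

Lemma are_words_collect n l : are_words n l -> are_words n (collect l).
Proof. by elim: l => //= e l IHl /andP[we /IHl]; apply: are_words_insert. Qed.

Lemma represents_boundary n : represents (@boundary p.+1 n) (boundary_sparse n).
Proof.
move=> l wl.
pose face i := face_l_sparse n i l ++ scale_sparse [:: -1] (face_r_sparse n i l).
have faceE (i : 'I_n) : are_words n.-1 (face i) /\
    denote n.-1 (face i) = face_l i (denote n l) - face_r i (denote n l).
  have [wfl Efl] := represents_face_l i wl; have [wfr Efr] := represents_face_r i wl.
  rewrite /face are_words_cat are_words_scale wfl wfr denote_cat denote_scale Efl Efr.
  by rewrite Poly_cons mulr0 addr0 polyCN scaleN1r.
rewrite /boundary_sparse denote_collect; split.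
  apply: are_words_collect; apply/allP => e /flattenP[l' /mapP[i]].
  rewrite mem_iota => /= ilt -> /mapP[e' e'f ->] /=.
  by have [/allP/(_ _ e'f)] := faceE (Ordinal ilt).
have denote_flatten (s : seq sparse) :
    denote n.-1 (flatten s) = \sum_(l' <- s) denote n.-1 l'.
  by elim: s => [|l' s IHs]; rewrite ?big_nil ?denote_nil // big_cons /= denote_cat IHs.
rewrite denote_flatten big_map -[n in iota 0 n]subn0 big_mkord /boundary.
apply: eq_bigr => i _; rewrite denote_scale -/(face i); have [_ ->] := faceE i.
congr (_ *: _); rewrite -signr_odd /=.
by case: (odd i); rewrite Poly_cons mulr0 addr0 ?polyCN ?expr0 ?expr1.
Qed.

End Denotation.

(** * Certificates for the reduced complexes *)

Section Elimination.
Variables (R : comNzRingType) (X : finType).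
Implicit Types (s : seq (X * free_mod R X)) (v : free_mod R X).

(** Forward elimination: the coordinate of v along x is read off at the leading word w,
    and v is replaced by what remains. These coordinates are dual to the vectors x if
    each x has coefficient 1 at its w and the later vectors do not involve w. *)
Fixpoint elim_coords s v : seq R :=
  if s is (w, x) :: s' then v w :: elim_coords s' (v - (v w : R) *: x) else [::].

Lemma size_elim_coords s v : size (elim_coords s v) = size s.
Proof. by elim: s v => //= -[w x] s IHs v /=; rewrite IHs. Qed.

Lemma elim_coords_linear s i :
  linear (fun v : free_mod R X => nth 0 (elim_coords s v) i : R^o).
Proof.
elim: s i => [|[w x] s IHs] i a u v; first by rewrite !nth_nil scaler0 addr0.
case: i => [|i] /=; first by rewrite !ffunE.
rewrite -IHs; congr (nth _ (elim_coords s _) _).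
by rewrite !ffunE scalerBr scalerA scalerDl opprD addrACA.
Qed.

Lemma elim_coords_eq0 s v :
  (forall w, w \in unzip1 s -> v w = 0) <->
  (forall i, (i < size s)%N -> nth 0 (elim_coords s v) i = 0).
Proof.
elim: s => [|[w x] s IHs] //=.
split=> [v0 i|el0].
  have vw : v w = 0 by apply: v0; rewrite mem_head.
  rewrite vw scale0r subr0; case: i => // i; rewrite ltnS => ilt.
  apply: (proj1 IHs _ i ilt) => w' w's.
  by apply: v0; rewrite inE w's orbT.
have vw : v w = 0 by exact: el0 0%N _.
move=> w'; rewrite inE => /predU1P[->//|]; apply: (proj2 IHs) => i /(el0 i.+1).
by rewrite /= vw scale0r subr0.
Qed.

End Elimination.

Fixpoint elim_sparse (s : seq (word * sparse)) (l : sparse) : seq (seq int) :=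
  if s is (w, x) :: s' then
    let c := coef_at l w in
    c :: elim_sparse s' (if zero_coefs c then l
                         else collect (l ++ scale_sparse (opp_coefs c) x))
  else [::].

Lemma size_elim_sparse s l : size (elim_sparse s l) = size s.
Proof. by elim: s l => //= -[w x] s IHs l /=; rewrite IHs. Qed.

(** An entry (d, w, h) describes a basis element x of the cycles with leading word w
    whose class is annihilated by 1 - 'X^d: for d > 0 the boundary of h is (1 - 'X^d) x up to
    degenerate chains, and for d = 0 the word w is itself the cycle x. *)
Definition entry := (nat * word * sparse)%type.

Section Check.
Variables p n : nat.

Definition full_word (w : word) : bool := all [in w] (iota 1 p).

Definition vanishes (l : sparse) : bool :=
  all (fun e => full_word e.2 ==> zero_coefs e.1) l.

Definition cycle_of (e : entry) : sparse :=
  if e.1.1 is 0 then [:: ([:: 1], e.1.2)]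
  else [seq (quo_oneBX e.1.1 c.1, c.2) | c <- boundary_sparse n.+1 e.2 & full_word c.2].

Fixpoint all_words (l : nat) : seq word :=
  if l is l'.+1 then [seq a :: w | a <- iota 0 p.+1, w <- all_words l'] else [:: [::]].

Definition boundary_word l (w : word) : sparse := boundary_sparse l [:: ([:: 1], w)].

(** Independence of the boundaries of the words j: the boundary of j involves r, while
    the boundaries of the later j' do not. *)
Fixpoint check_pivots (js : seq (word * word)) : bool :=
  if js is (j, r) :: js' then
    [&& is_word p n j, is_word p n.-1 r, full_word r,
        ~~ zero_coefs (coef_at (boundary_word n j) r),
        all (fun jr => zero_coefs (coef_at (boundary_word n jr.1) r)) js'
      & check_pivots js']
  else true.

(** The third condition is duality of the x and the coordinates. In the fourth one full
    words suffice, because the boundaries of the other words are degenerate and the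
    coordinates are read off at full words. The last two conditions give injectivity of
    the coordinates on cycles: if they vanish, only pivots are left. *)
Definition check (tab : seq entry) (js : seq (word * word)) : bool :=
  let s := [seq (e.1.2, cycle_of e) | e <- tab] in
  [&& all (fun e => [&& is_word p n e.1.2, full_word e.1.2 & are_words p n.+1 e.2]) tab,
      all (fun e => let x := cycle_of e in
        [&& are_words p n x, vanishes (boundary_sparse n x)
          & vanishes (collect (boundary_sparse n.+1 e.2
               ++ scale_sparse (opp_coefs (oneBX e.1.1)) x))]) tab,
      all (fun j => let c := elim_sparse s (nth ([::], [::]) s j).2 in
         all (fun i => zero_coefs (add_coefs (nth [::] c i)
                                     (if i == j then [:: -1] else [::])))
           (iota 0 (size tab))) (iota 0 (size tab)),
      all (fun u => full_word u ==>
         all (fun ce => dvd_oneBX ce.2.1.1 ce.1)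
           (zip (elim_sparse s (boundary_word n.+1 u)) tab))
        (all_words n.+1),
      all (fun w => full_word w ==> (w \in unzip1 s) || (w \in unzip1 js)) (all_words n)
    & check_pivots js].

Lemma full_letters l (t : l.-tuple 'I_p.+1) : full_word (letters t) = full t.
Proof.
apply/allP/forallP => [t_full i|t_full a].
  have /t_full/mapP[b bt] : i.+1 \in iota 1 p by rewrite mem_iota add1n !ltnS /=.
  by move=> ib; rewrite (_ : lift ord0 i = b) //; apply: val_inj; rewrite -ib.
rewrite mem_iota add1n ltnS; case: a => // a /= ap.
by apply/mapP; exists (lift ord0 (Ordinal ap)).
Qed.

Lemma mem_all_words l (t : l.-tuple 'I_p.+1) : letters t \in all_words l.
Proof.
elim: l t => [|l IHl] t; first by rewrite tuple0.
rewrite (tuple_eta t) [all_words _]/(allpairs cons (iota 0 p.+1) (all_words l)).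
apply/allpairsP; exists (val (thead t), letters [tuple of behead t]).
by split; rewrite ?IHl // [_.1]/= mem_iota ltn_ord.
Qed.

Lemma vanishes_degenerate i l : vanishes l -> degenerate (denote p i l).
Proof.
move=> l0 t t_full; rewrite ffunE; elim: l l0 => [|[c v] l IHl] //= /andP[cv /IHl l0].
case: eqP cv => [->|] //; rewrite full_letters t_full /= zero_coefsE => /eqP c0.
by rewrite Poly_add c0 l0 addr0.
Qed.

Definition tuple_of_word (w : word) : n.-tuple 'I_p.+1 :=
  [tuple inord (nth 0%N w l) | l < n].

Lemma tuple_of_wordK w : is_word p n w -> letters (tuple_of_word w) = w.
Proof.
case/is_wordP => t ->; congr letters; apply: eq_from_tnth => l.
by rewrite tnth_mktuple nth_letters inord_val.
Qed.

Definition denote_basis (s : seq (word * sparse)) :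
    seq (n.-tuple 'I_p.+1 * chain p.+1 n) :=
  [seq (tuple_of_word wx.1, denote p n wx.2) | wx <- s].

Lemma elim_sparseE s l : all (fun wx => is_word p n wx.1) s ->
  map Poly (elim_sparse s l) = elim_coords (denote_basis s) (denote p n l).
Proof.
elim: s l => [|[w x] s IHs] l //= /andP[ww ws]; rewrite IHs //.
have -> : denote p n l (tuple_of_word w) = Poly (coef_at l w).
  by rewrite ffunE tuple_of_wordK.
congr (_ :: elim_coords _ _); case: ifP => [|_].
  by rewrite zero_coefsE => /eqP->; rewrite scale0r subr0.
by rewrite denote_collect denote_cat denote_scale Poly_opp scaleNr.
Qed.

Lemma boundary_wordE l (t : l.-tuple 'I_p.+1) :
  denote p l.-1 (boundary_word l (letters t)) = boundary (basis_elt t).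
Proof.
have [|_ ->] := @represents_boundary p l [:: ([:: 1], letters t)].
  by rewrite /are_words /= andbT; apply/is_wordP; exists t.
by rewrite denote1 Poly_cons mulr0 addr0 scale1r.
Qed.

(** The coefficient of r in the boundary of v only comes from the first pivot j,
    so v vanishes at j; repeat with the other pivots. *)
Lemma check_pivotsP js (v : chain p.+1 n) :
  check_pivots js -> degenerate (boundary v) ->
  (forall t, full t -> letters t \notin unzip1 js -> v t = 0) -> degenerate v.
Proof.
move=> + bv; elim: js => [|[j r] js IHs]; first by move=> _ v0 t tf; exact: v0.
case/and5P => /is_wordP[tj ->] /is_wordP[tr ->]; rewrite full_letters => tr_full jr0.
case/andP => js0 js_ok; rewrite [unzip1 _]/= => v0; apply: IHs => // t tf t_js.
have [tj_eq|tj_neq] := eqVneq t tj; last first.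
  by apply: v0; rewrite // inE (inj_eq (@letters_inj _ _)) negb_or tj_neq.
have coefE s : Poly (coef_at (boundary_word n (letters s)) (letters tr))
    = boundary (basis_elt s : chain p.+1 n) tr.
  by rewrite -boundary_wordE ffunE.
have : boundary v tr = 0 by apply: bv.
rewrite [v in boundary v]free_mod_expand linear_sum sum_ffunE.
under eq_bigr => s _ do rewrite linearZ ffunE -(coefE s).
rewrite (bigD1 tj) //= big1 ?addr0 => [|s sj].
  move=> v_tj.
  have /eqP : (v tj : k) * Poly (coef_at (boundary_word n (letters tj)) (letters tr)) = 0.
    exact: v_tj.
  by rewrite mulf_eq0 -zero_coefsE (negPf jr0) orbF tj_eq => /eqP.
have [s_full|s_nfull] := boolP (full s); last first.
  rewrite (coefE s) (@degenerate_boundary _ _ (basis_elt s)) ?scaler0 // => s' s'f.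
  by rewrite ffunE; case: eqP s'f s_nfull => // -> ->.
have [/mapP[jr jrs sE]|s_js] := boolP (letters s \in unzip1 js).
  by rewrite sE; move: (allP js0 _ jrs); rewrite zero_coefsE => /eqP->; rewrite scaler0.
rewrite v0 ?scale0r // inE (inj_eq (@letters_inj _ _)) negb_or sj.
exact: s_js.
Qed.

Variables (tab : seq entry) (js : seq (word * word)).
Let e0 : entry := (0%N, [::], [::]).
Let deg (i : 'I_(size tab)) : nat := (nth e0 tab i).1.1.

Lemma check_reduced_cyclic_basis :
  check tab js -> reduced_cyclic_basis n (fun d => 1 - y2 ^+ d) p deg.
Proof.
case/and5P; set s := [seq _ | e <- tab].
move=> /allP words_ok /allP cycles_ok /allP dual_ok /allP bound_ok.
case/andP => /allP cover_ok piv_ok.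
have in_tab (i : 'I_(size tab)) : nth e0 tab i \in tab by apply: mem_nth.
have s_words : all (fun wx => is_word p n wx.1) s.
  by apply/allP => _ /mapP[e /words_ok/and3P[we _ _] ->].
have s_unzip w : w \in unzip1 (denote_basis s) -> full w.
  rewrite /unzip1 /denote_basis /s -!map_comp.
  case/mapP => e /words_ok/and3P[we fe _] -> /=.
  by rewrite -full_letters tuple_of_wordK.
pose phi_fun i (v : chain p.+1 n) : k^o := nth 0 (elim_coords (denote_basis s) v) i.
pose phi i : {linear chain p.+1 n -> k^o} :=
  HB.pack (phi_fun i) (GRing.isLinear.Build k (chain p.+1 n) k^o *:%R (phi_fun i)
    (elim_coords_linear (denote_basis s) i)).
have size_s : size (denote_basis s) = size tab by rewrite !size_map.
have phi_deg i c : degenerate c -> phi i c = 0.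
  move=> c_deg; have [ilt|ige] := ltnP i (size (denote_basis s)).
    by apply: (proj1 (elim_coords_eq0 _ _)) ilt => w /s_unzip/c_deg.
  by rewrite /= /phi_fun nth_default // size_elim_coords.
have phiE i l : (i < size tab)%N ->
    phi i (denote p n l) = Poly (nth [::] (elim_sparse s l) i).
  move=> ilt; rewrite /= /phi_fun -elim_sparseE //.
  by rewrite (nth_map [::]) // size_elim_sparse size_map.
pose x (i : 'I_(size tab)) := denote p n (cycle_of (nth e0 tab i)).
exists x, (fun i => phi i); split=> //.
- move=> i c; exact: phi_deg.
- move=> i; have /and3P[wx vx _] := cycles_ok _ (in_tab i).
  have [_ <-] := represents_boundary wx; exact: vanishes_degenerate.
- move=> i j; rewrite phiE //.
  have ji : val j \in iota 0 (size tab) by rewrite mem_iota /=.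
  have ii : val i \in iota 0 (size tab) by rewrite mem_iota /=.
  have /allP/(_ _ ii) := dual_ok _ ji.
  rewrite (nth_map e0) //= zero_coefsE Poly_add addr_eq0 => /eqP->.
  rewrite -(inj_eq val_inj) /=; case: eqP => _; last by rewrite oppr0.
  by rewrite Poly_cons mulr0 addr0 polyCN opprK.
- move=> v bv phi0; apply: check_pivotsP piv_ok bv _ => t t_full t_js.
  have := cover_ok _ (mem_all_words t).
  rewrite full_letters t_full (negPf t_js) orbF /=.
  case/mapP => _ /mapP[e e_tab ->] /= tE.
  have -> : t = tuple_of_word e.1.2.
    apply: letters_inj; rewrite tE tuple_of_wordK //.
    by have /and3P[] := words_ok _ e_tab.
  apply: (proj2 (elim_coords_eq0 (denote_basis s) v)) => [i|].
    by rewrite size_s => ilt; exact: phi0 (Ordinal ilt).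
  by rewrite /unzip1 /denote_basis /s -!map_comp; apply/mapP; exists e.
split=> [i|i u].
  have /and3P[we _ wh] := words_ok _ (in_tab i).
  have /and3P[wx _ vx] := cycles_ok _ (in_tab i).
  exists (denote p n.+1 (nth e0 tab i).2).
  have := @vanishes_degenerate n _ vx.
  rewrite denote_collect denote_cat denote_scale Poly_opp Poly_oneBX scaleNr.
  by have [_ ->] := represents_boundary wh.
have r_basis (t : n.+1.-tuple 'I_p.+1) :
    exists r, phi i (boundary (basis_elt t)) = r * (1 - y2 ^+ deg i).
  have [t_full|t_nfull] := boolP (full t); last first.
    exists 0; rewrite mul0r phi_deg //; apply: (@degenerate_boundary p n.+1) => t' t'f.
    by rewrite ffunE; case: eqP t'f t_nfull => // -> ->.
  rewrite -[boundary _](@boundary_wordE n.+1) phiE //.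
  apply: dvd_oneBXP; have := bound_ok _ (mem_all_words t).
  rewrite full_letters t_full => /allP; set l := elim_sparse _ _ => H.
  have size_l : size l = size tab by rewrite size_elim_sparse size_map.
  apply: (H (nth [::] l i, nth e0 tab i)); rewrite -nth_zip //.
  by apply: mem_nth; rewrite size_zip size_l minnn.
have [r rE] := choice r_basis.
exists (\sum_t u t * r t).
have -> : boundary u = \sum_t (u t : k) *: boundary (basis_elt t : chain p.+1 n.+1).
  rewrite [in LHS](free_mod_expand u) linear_sum; apply: eq_bigr => t _.
  by rewrite linearZ.
rewrite linear_sum mulr_suml; apply: eq_bigr => t _.
by rewrite linearZ -mulrA -rE.
Qed.

End Check.

(** * Tables of adapted bases *)

(** The p-th list concerns the reduced complex on p + 1 letters. Besides its leading
    word, an x only involves leading words of later entries and pivots. The last entry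
    is the free one; its cycle is the weakly decreasing word with one each of the letters
    p, ..., 1, completed by zeros. *)
Definition tables : seq (seq entry) := [::
  [:: (0, [:: 0; 0; 0; 0], [::])];
  [:: (1, [:: 1; 1; 0; 1], [:: ([:: 1]%Z, [:: 1; 1; 0; 1; 1])]);
   (1, [:: 0; 1; 1; 1], [:: ([:: -1]%Z, [:: 0; 0; 1; 1; 1])]);
   (1, [:: 0; 0; 0; 1], [:: ([:: 1]%Z, [:: 0; 0; 0; 1; 1])]);
   (1, [:: 0; 1; 0; 1], [:: ([:: -1]%Z, [:: 0; 1; 0; 0; 1])]);
   (1, [:: 1; 0; 1; 0], [:: ([:: -1]%Z, [:: 1; 0; 1; 1; 0])]);
   (1, [:: 0; 1; 0; 0], [:: ([:: -1]%Z, [:: 0; 0; 1; 0; 0])]);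
   (2, [:: 1; 1; 1; 1], [:: ([:: -1]%Z, [:: 1; 1; 0; 0; 1]); ([:: -1]%Z, [:: 1; 1; 0; 1; 1])]);
   (2, [:: 1; 1; 0; 0], [:: ([:: -1]%Z, [:: 0; 1; 1; 0; 0]); ([:: -1]%Z, [:: 0; 0; 1; 0; 0])]);
   (2, [:: 1; 1; 1; 0], [:: ([:: 1]%Z, [:: 1; 0; 0; 1; 0]); ([:: 1]%Z, [:: 1; 0; 1; 1; 0])]);
   (2, [:: 0; 0; 1; 1], [:: ([:: -1]%Z, [:: 0; 0; 0; 0; 1]); ([:: -1]%Z, [:: 0; 0; 0; 1; 1]);
      ([:: 0; 0; 1]%Z, [:: 0; 0; 1; 0; 0])]);
   (0, [:: 1; 0; 0; 0], [::])];
  [:: (1, [:: 2; 1; 2; 0], [:: ([:: 1]%Z, [:: 2; 0; 2; 1; 0])]);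
   (1, [:: 1; 2; 0; 0], [:: ([:: 1]%Z, [:: 1; 2; 2; 0; 0])]);
   (1, [:: 2; 2; 1; 2], [:: ([:: -1]%Z, [:: 2; 2; 0; 2; 1])]);
   (1, [:: 1; 2; 1; 1], [:: ([:: -1]%Z, [:: 1; 1; 2; 1; 1])]);
   (1, [:: 0; 2; 1; 1], [:: ([:: -1]%Z, [:: 0; 0; 2; 1; 1])]);
   (1, [:: 0; 0; 1; 2], [:: ([:: 1]%Z, [:: 1; 0; 0; 2; 2])]);
   (1, [:: 2; 2; 0; 1], [:: ([:: -1]%Z, [:: 2; 2; 0; 0; 1])]);
   (1, [:: 0; 2; 1; 0], [:: ([:: -1]%Z, [:: 0; 0; 2; 1; 0])]);
   (1, [:: 2; 0; 1; 0], [:: ([:: 1]%Z, [:: 2; 0; 0; 1; 0])]);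
   (1, [:: 1; 2; 1; 0], [:: ([:: -1]%Z, [:: 1; 1; 2; 1; 0])]);
   (1, [:: 2; 1; 2; 1], [:: ([:: 1]%Z, [:: 2; 1; 1; 2; 1])]);
   (1, [:: 2; 1; 0; 1], [:: ([:: 1]%Z, [:: 2; 1; 0; 1; 1])]);
   (1, [:: 1; 2; 2; 2], [:: ([:: -1]%Z, [:: 1; 1; 2; 2; 2])]);
   (1, [:: 0; 1; 2; 2], [:: ([:: -1]%Z, [:: 0; 0; 2; 2; 1])]);
   (1, [:: 1; 1; 1; 2], [:: ([:: 1]%Z, [:: 1; 1; 1; 2; 2])]);
   (1, [:: 0; 2; 0; 1], [:: ([:: -1]%Z, [:: 0; 0; 2; 0; 1])]);
   (1, [:: 1; 1; 0; 2], [:: ([:: 1]%Z, [:: 1; 1; 0; 2; 2])]);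
   (1, [:: 1; 2; 0; 2], [:: ([:: 1]%Z, [:: 1; 2; 2; 0; 2]);
      ([:: 0; 0; 1]%Z, [:: 2; 2; 0; 0; 1])]);
   (1, [:: 2; 1; 0; 2], [:: ([:: 1]%Z, [:: 2; 1; 0; 2; 2]);
      ([:: 0; -1]%Z, [:: 2; 0; 2; 1; 0])]);
   (1, [:: 2; 1; 2; 2], [:: ([:: -1]%Z, [:: 2; 0; 2; 2; 1]);
      ([:: 0; 1]%Z, [:: 2; 2; 0; 0; 1])]);
   (1, [:: 1; 0; 2; 0], [:: ([:: 1]%Z, [:: 1; 0; 0; 2; 0]);
      ([:: 0; -1]%Z, [:: 1; 2; 2; 0; 0])]);
   (1, [:: 1; 2; 0; 1], [:: ([:: -1]%Z, [:: 1; 1; 2; 0; 1]);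
      ([:: 0; -1]%Z, [:: 2; 1; 0; 1; 1])]);
   (1, [:: 1; 2; 1; 2], [:: ([:: 1]%Z, [:: 1; 2; 2; 1; 2]);
      ([:: -1; -1; -1]%Z, [:: 2; 2; 0; 2; 1])]);
   (1, [:: 0; 1; 0; 2], [:: ([:: -1]%Z, [:: 0; 1; 0; 0; 2]);
      ([:: 0; 0; -1; 1]%Z, [:: 1; 2; 2; 0; 0])]);
   (1, [:: 0; 1; 1; 2], [:: ([:: -1]%Z, [:: 0; 0; 1; 2; 1]); ([:: 0; -1]%Z, [:: 0; 0; 2; 1; 1]);
      ([:: 1; 1]%Z, [:: 1; 0; 0; 2; 2])]);
   (1, [:: 0; 2; 1; 2], [:: ([:: -1]%Z, [:: 0; 0; 2; 1; 2]); ([:: 1; 1]%Z, [:: 1; 0; 0; 2; 2]);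
      ([:: 0; -1]%Z, [:: 0; 0; 2; 2; 1])]);
   (1, [:: 0; 1; 2; 1], [:: ([:: -1]%Z, [:: 1; 0; 1; 2; 1]); ([:: 0; -1]%Z, [:: 1; 1; 2; 1; 1]);
      ([:: -1]%Z, [:: 1; 1; 1; 2; 2])]);
   (1, [:: 0; 1; 2; 0], [:: ([:: -1]%Z, [:: 0; 1; 2; 1; 0]);
      ([:: 0; 0; 1]%Z, [:: 1; 2; 2; 0; 0]); ([:: 1; 0; 1]%Z, [:: 1; 1; 2; 1; 0])]);
   (1, [:: 2; 0; 1; 2], [:: ([:: -1]%Z, [:: 2; 1; 0; 0; 2]); ([:: -1]%Z, [:: 2; 1; 0; 2; 2]);
      ([:: 1; 1]%Z, [:: 2; 0; 2; 2; 1]); ([:: 0; -1; -1]%Z, [:: 2; 2; 0; 0; 1])]);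
   (1, [:: 1; 0; 2; 1], [:: ([:: 1]%Z, [:: 1; 0; 0; 2; 1]); ([:: 0; 1]%Z, [:: 1; 1; 0; 2; 2]);
      ([:: 0; 1]%Z, [:: 1; 1; 2; 0; 1]); ([:: 0; 0; 1]%Z, [:: 2; 1; 0; 1; 1])]);
   (1, [:: 2; 1; 1; 2], [:: ([:: -1]%Z, [:: 2; 1; 0; 2; 1]); ([:: 0; -1]%Z, [:: 2; 2; 0; 0; 1]);
      ([:: 0; -1]%Z, [:: 2; 1; 1; 2; 1]); ([:: 0; -1]%Z, [:: 2; 1; 0; 1; 1]);
      ([:: -1]%Z, [:: 2; 1; 0; 0; 2])]);
   (1, [:: 1; 1; 2; 0], [:: ([:: 1]%Z, [:: 0; 2; 2; 1; 0]); ([:: 1]%Z, [:: 0; 0; 2; 1; 0]);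
      ([:: 0; -1]%Z, [:: 1; 0; 0; 2; 0]); ([:: 1]%Z, [:: 0; 1; 2; 1; 0]);
      ([:: -1; 0; -1]%Z, [:: 1; 1; 2; 1; 0])]);
   (1, [:: 1; 0; 2; 2], [:: ([:: 1]%Z, [:: 1; 0; 2; 2; 1]); ([:: 0; 1]%Z, [:: 0; 0; 2; 1; 1]);
      ([:: 1]%Z, [:: 1; 0; 1; 2; 1]); ([:: 0; 1]%Z, [:: 1; 1; 2; 1; 1]);
      ([:: 1]%Z, [:: 1; 1; 1; 2; 2]); ([:: 1]%Z, [:: 1; 0; 0; 2; 1]);
      ([:: 0; 1]%Z, [:: 1; 1; 0; 2; 2])]);
   (2, [:: 2; 2; 1; 1], [:: ([:: -1]%Z, [:: 1; 2; 2; 1; 1]); ([:: -1]%Z, [:: 1; 1; 2; 1; 1])]);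
   (2, [:: 2; 1; 1; 1], [:: ([:: -1]%Z, [:: 2; 1; 0; 0; 1]); ([:: -1]%Z, [:: 2; 1; 0; 1; 1])]);
   (2, [:: 2; 2; 1; 0], [:: ([:: -1]%Z, [:: 1; 2; 2; 1; 0]); ([:: -1]%Z, [:: 1; 1; 2; 1; 0])]);
   (2, [:: 2; 1; 1; 0], [:: ([:: -1]%Z, [:: 2; 1; 1; 2; 0]); ([:: 1]%Z, [:: 2; 0; 2; 1; 0])]);
   (2, [:: 1; 1; 2; 2], [:: ([:: -1]%Z, [:: 0; 1; 2; 2; 1]); ([:: -1]%Z, [:: 0; 0; 2; 2; 1]);
      ([:: 0; -1]%Z, [:: 1; 0; 2; 2; 1])]);
   (2, [:: 2; 2; 2; 1], [:: ([:: 1]%Z, [:: 2; 1; 2; 2; 1]); ([:: 1]%Z, [:: 2; 1; 1; 2; 1]);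
      ([:: -1]%Z, [:: 2; 1; 0; 0; 1]); ([:: -1]%Z, [:: 2; 1; 0; 1; 1])]);
   (0, [:: 2; 1; 0; 0], [::])];
  [:: (1, [:: 2; 3; 0; 1], [:: ([:: -1]%Z, [:: 2; 3; 0; 0; 1])]);
   (1, [:: 3; 2; 1; 2], [:: ([:: -1]%Z, [:: 3; 2; 0; 2; 1])]);
   (1, [:: 2; 3; 1; 0], [:: ([:: 1]%Z, [:: 2; 3; 3; 1; 0])]);
   (1, [:: 2; 3; 1; 1], [:: ([:: -1]%Z, [:: 2; 2; 3; 1; 1])]);
   (1, [:: 3; 1; 2; 1], [:: ([:: -1]%Z, [:: 3; 2; 1; 3; 1])]);
   (1, [:: 1; 3; 0; 2], [:: ([:: -1]%Z, [:: 1; 3; 0; 0; 2])]);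
   (1, [:: 2; 3; 1; 2], [:: ([:: -1]%Z, [:: 2; 3; 0; 2; 1])]);
   (1, [:: 1; 2; 3; 0], [:: ([:: 1]%Z, [:: 1; 0; 2; 3; 0])]);
   (1, [:: 3; 1; 2; 0], [:: ([:: -1]%Z, [:: 3; 2; 1; 3; 0])]);
   (1, [:: 1; 1; 2; 3], [:: ([:: 1]%Z, [:: 2; 1; 1; 3; 3])]);
   (1, [:: 3; 2; 3; 1], [:: ([:: 1]%Z, [:: 3; 1; 3; 2; 1])]);
   (1, [:: 3; 3; 1; 2], [:: ([:: 1]%Z, [:: 3; 3; 2; 1; 3])]);
   (1, [:: 2; 1; 0; 3], [:: ([:: -1]%Z, [:: 2; 1; 0; 0; 3])]);
   (1, [:: 2; 2; 1; 3], [:: ([:: 1]%Z, [:: 2; 2; 1; 3; 3])]);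
   (1, [:: 3; 2; 0; 1], [:: ([:: 1]%Z, [:: 3; 2; 1; 0; 2])]);
   (1, [:: 2; 3; 2; 1], [:: ([:: 1]%Z, [:: 2; 3; 3; 2; 1])]);
   (1, [:: 1; 3; 2; 2], [:: ([:: -1]%Z, [:: 1; 1; 3; 2; 2])]);
   (1, [:: 1; 2; 3; 3], [:: ([:: -1]%Z, [:: 1; 1; 3; 3; 2])]);
   (1, [:: 3; 1; 2; 3], [:: ([:: -1]%Z, [:: 3; 1; 0; 3; 2])]);
   (1, [:: 1; 2; 3; 2], [:: ([:: -1]%Z, [:: 2; 1; 2; 3; 2])]);
   (1, [:: 0; 1; 3; 2], [:: ([:: -1]%Z, [:: 0; 0; 3; 2; 1])]);
   (1, [:: 1; 3; 1; 2], [:: ([:: -1]%Z, [:: 1; 1; 3; 1; 2])]);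
   (1, [:: 2; 3; 3; 1], [:: ([:: 1]%Z, [:: 0; 3; 3; 2; 1])]);
   (1, [:: 0; 1; 2; 3], [:: ([:: -1]%Z, [:: 0; 0; 2; 3; 1])]);
   (1, [:: 1; 1; 3; 2], [:: ([:: -1]%Z, [:: 1; 0; 3; 2; 1])]);
   (1, [:: 3; 1; 0; 2], [:: ([:: -1]%Z, [:: 3; 2; 1; 0; 3]); ([:: 1]%Z, [:: 3; 2; 1; 0; 2])]);
   (1, [:: 3; 1; 3; 2], [:: ([:: -1]%Z, [:: 3; 0; 3; 2; 1]); ([:: 1]%Z, [:: 3; 1; 3; 2; 1])]);
   (1, [:: 1; 3; 2; 0], [:: ([:: 1]%Z, [:: 0; 3; 2; 1; 0]); ([:: 1]%Z, [:: 2; 3; 3; 1; 0])]);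
   (1, [:: 1; 0; 2; 3], [:: ([:: 1]%Z, [:: 2; 1; 0; 3; 3]); ([:: 1]%Z, [:: 2; 1; 0; 0; 3])]);
   (1, [:: 2; 1; 3; 1], [:: ([:: 1]%Z, [:: 2; 1; 1; 3; 1]); ([:: 0; 1]%Z, [:: 2; 2; 3; 1; 1])]);
   (1, [:: 3; 2; 1; 3], [:: ([:: -1]%Z, [:: 3; 2; 1; 1; 3]);
      ([:: 0; -1]%Z, [:: 3; 1; 3; 2; 1])]);
   (1, [:: 2; 1; 3; 0], [:: ([:: 1]%Z, [:: 2; 0; 1; 3; 0]);
      ([:: 0; -1]%Z, [:: 2; 3; 3; 1; 0])]);
   (1, [:: 0; 3; 1; 2], [:: ([:: -1]%Z, [:: 0; 0; 3; 1; 2]);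
      ([:: 0; -1]%Z, [:: 0; 0; 3; 2; 1])]);
   (1, [:: 3; 0; 1; 2], [:: ([:: -1]%Z, [:: 3; 0; 0; 2; 1]);
      ([:: 0; 1]%Z, [:: 3; 2; 1; 0; 3])]);
   (1, [:: 2; 1; 2; 3], [:: ([:: -1]%Z, [:: 2; 0; 2; 3; 1]);
      ([:: 0; 1]%Z, [:: 2; 3; 3; 2; 1])]);
   (1, [:: 0; 2; 1; 3], [:: ([:: -1]%Z, [:: 0; 0; 2; 1; 3]);
      ([:: 0; -1]%Z, [:: 0; 0; 2; 3; 1])]);
   (1, [:: 3; 1; 2; 2], [:: ([:: -1]%Z, [:: 3; 0; 2; 2; 1]);
      ([:: 0; -1]%Z, [:: 3; 2; 1; 0; 2])]);
   (1, [:: 1; 2; 1; 3], [:: ([:: -1]%Z, [:: 1; 2; 1; 1; 3]);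
      ([:: 0; 0; 1; -1]%Z, [:: 2; 2; 3; 1; 1])]);
   (1, [:: 1; 2; 2; 3], [:: ([:: -1]%Z, [:: 0; 2; 2; 3; 1]);
      ([:: 0; 1; -1]%Z, [:: 2; 3; 3; 2; 1])]);
   (1, [:: 3; 1; 1; 2], [:: ([:: 1]%Z, [:: 3; 2; 0; 3; 1]); ([:: 0; 1]%Z, [:: 3; 2; 1; 0; 2]);
      ([:: -1]%Z, [:: 3; 2; 1; 1; 3])]);
   (1, [:: 0; 3; 2; 1], [:: ([:: -1]%Z, [:: 1; 3; 3; 2; 1]); ([:: 0; -1]%Z, [:: 3; 2; 1; 3; 1]);
      ([:: 1]%Z, [:: 0; 3; 3; 2; 1])]);
   (1, [:: 1; 2; 0; 3], [:: ([:: -1]%Z, [:: 2; 1; 2; 0; 3]);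
      ([:: 0; 0; 0; 1]%Z, [:: 3; 2; 1; 3; 0]); ([:: 0; 1]%Z, [:: 2; 1; 0; 0; 3])]);
   (1, [:: 1; 2; 3; 1], [:: ([:: -1]%Z, [:: 2; 1; 2; 3; 1]);
      ([:: 0; 0; -1]%Z, [:: 3; 2; 1; 3; 1]); ([:: 0; 1]%Z, [:: 2; 3; 3; 2; 1])]);
   (1, [:: 1; 3; 2; 1], [:: ([:: -1]%Z, [:: 2; 1; 3; 2; 1]); ([:: 0; 1]%Z, [:: 3; 2; 1; 3; 1]);
      ([:: 0; 1]%Z, [:: 2; 3; 3; 2; 1]); ([:: -1]%Z, [:: 2; 1; 1; 3; 1])]);
   (1, [:: 1; 3; 2; 3], [:: ([:: -1]%Z, [:: 0; 3; 2; 3; 1]);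
      ([:: 0; -1; -1; -1]%Z, [:: 3; 1; 3; 2; 1]); ([:: 0; 0; 1]%Z, [:: 3; 2; 1; 0; 2]);
      ([:: 0; -1]%Z, [:: 0; 3; 3; 2; 1])]);
   (1, [:: 2; 0; 1; 3], [:: ([:: -1]%Z, [:: 2; 0; 0; 3; 1]); ([:: 0; -1]%Z, [:: 2; 3; 0; 0; 1]);
      ([:: 0; 0; -1; -1]%Z, [:: 2; 3; 3; 1; 0]); ([:: 0; 1]%Z, [:: 2; 1; 0; 0; 3]);
      ([:: 0; 0; 1]%Z, [:: 2; 0; 1; 3; 0])]);
   (1, [:: 2; 1; 1; 3], [:: ([:: -1]%Z, [:: 2; 1; 0; 3; 1]); ([:: 0; -1]%Z, [:: 2; 3; 0; 0; 1]);
      ([:: 0; 0; -1]%Z, [:: 2; 3; 3; 1; 0]); ([:: -1]%Z, [:: 2; 1; 0; 0; 3]);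
      ([:: 0; -1]%Z, [:: 2; 1; 1; 3; 1]); ([:: 0; 0; -1]%Z, [:: 2; 2; 3; 1; 1])]);
   (1, [:: 2; 1; 3; 2], [:: ([:: -1]%Z, [:: 2; 0; 3; 2; 1]); ([:: 0; 1]%Z, [:: 2; 3; 0; 0; 1]);
      ([:: 0; 0; 1]%Z, [:: 2; 3; 3; 1; 0]); ([:: 0; 0; 1]%Z, [:: 2; 3; 3; 2; 1]);
      ([:: 1]%Z, [:: 1; 3; 3; 2; 1]); ([:: -1]%Z, [:: 0; 3; 3; 2; 1]);
      ([:: 1]%Z, [:: 2; 1; 3; 2; 1]); ([:: 1]%Z, [:: 2; 1; 1; 3; 1])]);
   (1, [:: 2; 3; 1; 3], [:: ([:: -1]%Z, [:: 2; 3; 0; 3; 1]); ([:: 0; 1]%Z, [:: 2; 3; 0; 0; 1]);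
      ([:: 0; 0; 1]%Z, [:: 2; 3; 3; 1; 0]); ([:: 0; -1]%Z, [:: 1; 3; 3; 2; 1]);
      ([:: 0; -1]%Z, [:: 2; 1; 3; 2; 1]); ([:: 0; 0; 1]%Z, [:: 2; 3; 3; 2; 1]);
      ([:: 0; -1]%Z, [:: 2; 1; 1; 3; 1])]);
   (1, [:: 0; 2; 3; 1], [:: ([:: 1]%Z, [:: 2; 0; 3; 3; 1]); ([:: 0; -1]%Z, [:: 2; 3; 0; 0; 1]);
      ([:: 0; 0; -1]%Z, [:: 2; 3; 3; 1; 0]); ([:: 0; -1]%Z, [:: 0; 3; 3; 2; 1]);
      ([:: -1; 0; -1]%Z, [:: 1; 3; 3; 2; 1]); ([:: -1; 0; -1]%Z, [:: 2; 1; 3; 2; 1]);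
      ([:: 0; 1; 0; 1]%Z, [:: 2; 3; 3; 2; 1]); ([:: -1; 0; -1]%Z, [:: 2; 1; 1; 3; 1])]);
   (1, [:: 2; 1; 3; 3], [:: ([:: 1]%Z, [:: 2; 1; 0; 3; 2]); ([:: 1; 1]%Z, [:: 2; 1; 0; 0; 3]);
      ([:: 0; 0; 1]%Z, [:: 3; 2; 1; 0; 3]); ([:: 0; 0; -1]%Z, [:: 3; 2; 1; 0; 2]);
      ([:: 0; 0; 1]%Z, [:: 2; 0; 1; 3; 0]); ([:: -1]%Z, [:: 2; 0; 2; 3; 1]);
      ([:: 0; -1]%Z, [:: 2; 0; 3; 2; 1]); ([:: 0; 1; 1]%Z, [:: 2; 3; 0; 0; 1]);
      ([:: 1; 1; 1]%Z, [:: 1; 3; 3; 2; 1]); ([:: 1; 1; 1]%Z, [:: 2; 1; 3; 2; 1]);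
      ([:: 1; 1; 1]%Z, [:: 2; 1; 1; 3; 1]); ([:: -1]%Z, [:: 2; 0; 3; 3; 1]);
      ([:: 0; 0; 1]%Z, [:: 2; 3; 3; 1; 0])]);
   (2, [:: 3; 3; 2; 1], [:: ([:: -1]%Z, [:: 2; 2; 3; 2; 1]); ([:: -1]%Z, [:: 2; 3; 3; 2; 1])]);
   (2, [:: 3; 2; 2; 1], [:: ([:: 1]%Z, [:: 3; 1; 2; 2; 1]); ([:: -1]%Z, [:: 3; 2; 1; 3; 1])]);
   (2, [:: 3; 2; 1; 1], [:: ([:: -1]%Z, [:: 3; 2; 0; 1; 1]); ([:: 1]%Z, [:: 3; 2; 1; 0; 2])]);
   (0, [:: 3; 2; 1; 0], [::])];
  [:: (1, [:: 3; 4; 1; 2], [:: ([:: -1]%Z, [:: 3; 4; 1; 1; 2])]);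
   (1, [:: 1; 4; 2; 3], [:: ([:: 1]%Z, [:: 1; 4; 4; 2; 3])]);
   (1, [:: 4; 3; 1; 2], [:: ([:: -1]%Z, [:: 4; 3; 0; 2; 1])]);
   (1, [:: 4; 2; 3; 1], [:: ([:: -1]%Z, [:: 4; 2; 3; 3; 1])]);
   (1, [:: 3; 2; 1; 4], [:: ([:: -1]%Z, [:: 3; 2; 0; 4; 1])]);
   (1, [:: 2; 1; 3; 4], [:: ([:: -1]%Z, [:: 2; 1; 0; 3; 4])]);
   (1, [:: 1; 2; 3; 4], [:: ([:: -1]%Z, [:: 1; 2; 0; 3; 4])]);
   (1, [:: 3; 4; 2; 1], [:: ([:: -1]%Z, [:: 3; 3; 4; 2; 1])]);
   (1, [:: 1; 3; 2; 4], [:: ([:: -1]%Z, [:: 1; 3; 0; 2; 4])]);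
   (1, [:: 2; 4; 1; 3], [:: ([:: -1]%Z, [:: 2; 4; 1; 1; 3])]);
   (1, [:: 1; 2; 4; 3], [:: ([:: -1]%Z, [:: 1; 0; 4; 3; 2])]);
   (1, [:: 2; 3; 1; 4], [:: ([:: -1]%Z, [:: 2; 3; 1; 1; 4])]);
   (1, [:: 2; 3; 4; 1], [:: ([:: 1]%Z, [:: 2; 0; 4; 3; 1])]);
   (1, [:: 4; 1; 2; 3], [:: ([:: -1]%Z, [:: 4; 2; 1; 4; 3])]);
   (1, [:: 1; 3; 4; 2], [:: ([:: -1]%Z, [:: 3; 1; 3; 4; 2])]);
   (1, [:: 2; 1; 4; 3], [:: ([:: 1]%Z, [:: 2; 1; 4; 3; 2])]);
   (1, [:: 3; 1; 2; 4], [:: ([:: -1]%Z, [:: 3; 1; 0; 4; 2])]);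
   (1, [:: 1; 4; 3; 2], [:: ([:: 1]%Z, [:: 1; 4; 4; 3; 2])]);
   (1, [:: 4; 2; 1; 3], [:: ([:: -1]%Z, [:: 4; 2; 1; 1; 3]);
      ([:: 0; 1]%Z, [:: 4; 2; 3; 3; 1])]);
   (1, [:: 2; 4; 3; 1], [:: ([:: 1]%Z, [:: 1; 4; 3; 2; 1]); ([:: -1]%Z, [:: 3; 3; 4; 2; 1])]);
   (1, [:: 4; 1; 3; 2], [:: ([:: -1]%Z, [:: 4; 0; 3; 2; 1]); ([:: -1]%Z, [:: 4; 2; 3; 3; 1])]);
   (1, [:: 3; 1; 4; 2], [:: ([:: -1]%Z, [:: 3; 0; 4; 2; 1]);
      ([:: 0; -1; -1]%Z, [:: 3; 3; 4; 2; 1])]);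
   (1, [:: 3; 2; 4; 1], [:: ([:: 1]%Z, [:: 3; 1; 4; 2; 1]); ([:: 0; 1]%Z, [:: 3; 3; 4; 2; 1])]);
   (0, [:: 4; 3; 2; 1], [::])]]%N.

(** The p-th list gives the remaining full words j of length 4 on p + 1 letters, each with
    a word r of length 3 as in [check_pivots]. *)
Definition pivots : seq (seq (word * word)) := [::
  [::];
  [:: ([:: 1; 0; 1; 1], [:: 1; 1; 1]); ([:: 1; 0; 0; 1], [:: 1; 0; 1]);
   ([:: 0; 1; 1; 0], [:: 1; 1; 0]); ([:: 0; 0; 1; 0], [:: 0; 1; 0])];
  [:: ([:: 0; 2; 2; 1], [:: 1; 2; 2]); ([:: 1; 0; 1; 2], [:: 1; 1; 2]);
   ([:: 0; 0; 2; 1], [:: 0; 2; 1]); ([:: 2; 0; 2; 1], [:: 2; 1; 2]);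
   ([:: 1; 2; 2; 1], [:: 2; 2; 1]); ([:: 1; 1; 2; 1], [:: 1; 2; 1]);
   ([:: 2; 0; 1; 1], [:: 2; 1; 1]); ([:: 2; 0; 0; 1], [:: 2; 0; 1]);
   ([:: 1; 0; 0; 2], [:: 1; 0; 2]); ([:: 1; 2; 2; 0], [:: 1; 2; 0])];
  [:: ([:: 1; 0; 3; 2], [:: 1; 2; 3]); ([:: 1; 3; 3; 2], [:: 1; 3; 2]);
   ([:: 2; 0; 3; 1], [:: 2; 1; 3]); ([:: 3; 0; 2; 1], [:: 3; 1; 2]);
   ([:: 2; 2; 3; 1], [:: 2; 3; 1])];
  [::]]%N.

(** * The fourth homology *)

Definition table (p : nat) : seq entry := nth [::] tables p.

Definition table_degree p (i : 'I_(size (table p))) : nat :=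
  (nth (0%N, [::], [::]) (table p) i).1.1.

Lemma full_size p n (t : n.-tuple 'I_p.+1) : full t -> (p <= n)%N.
Proof.
move/forallP => t_full; rewrite -(size_tuple t).
rewrite -[X in (X <= _)%N](card_ord p) cardE -(size_map (lift ord0)).
apply: uniq_leq_size => [|_ /mapP[i _ ->]]; last exact: t_full.
by rewrite map_inj_uniq ?enum_uniq //; apply: lift_inj.
Qed.

Lemma tables_checked :
  all (fun p => check p 4 (table p) (nth [::] pivots p)) (iota 0 5).
Proof. by vm_cast_no_check (erefl true). Qed.

(** For p >= 5 no word of length 4 is full, so the reduced complex is zero. *)
Lemma table_reduced_cyclic_basis p :
  reduced_cyclic_basis 4 (fun d => 1 - y2 ^+ d) p (@table_degree p).
Proof.
have [p5|p5] := ltnP p 5.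
  apply: (@check_reduced_cyclic_basis p 4 _ (nth [::] pivots p)).
  by apply: (allP tables_checked); rewrite mem_iota.
have not_full (t : 4.-tuple 'I_p.+1) : ~~ full t.
  by apply: contraL p5 => /full_size; rewrite -leqNgt.
have no_index : 'I_(size (table p)) -> False.
  by rewrite /table nth_default // => -[].
exists (fun _ => 0), (fun i => False_rect _ (no_index i)).
split=> [i|i|i|v _ _ t tf|]; try by case: (no_index i).
  by rewrite (negPf (not_full t)) in tf.
by split=> i; case: (no_index i).
Qed.

Definition degree_counts (j : nat) : seq nat :=
  [seq count (fun e : entry => e.1.1 == j) (table p) | p <- iota 0 5].

Lemma card_table_degree q j :
  #|[pred s : {S : {set 'I_q} & 'I_(size (table #|S|))} | table_degree (tagged s) == j]|
  = (\sum_(p < 5) 'C(q, p) * nth 0 (degree_counts j) p)%N.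
Proof.
pose cnt p := count (fun e : entry => e.1.1 == j) (table p).
have cntE p : #|[pred i : 'I_(size (table p)) | table_degree i == j]| = cnt p.
  rewrite -sum1_card /cnt -sum1_count (big_nth (0%N, [::], [::])) big_mkord.
  by apply: eq_bigl => i; rewrite inE.
rewrite (@card_tagged_pred _ _ (fun S : {set 'I_q} => [pred i | table_degree i == j])).
under eq_bigr => S _ do rewrite cntE.
rewrite (@sum_card_subsets q cnt 5) => [|p p5]; last by rewrite /cnt /table nth_default.
by apply: eq_bigr => p _; rewrite (nth_map 0%N) ?size_iota // nth_iota.
Qed.

Lemma table_degree_lt3 p (i : 'I_(size (table p))) : (table_degree i < 3)%N.
Proof.
have /all_nthP : all (fun e : entry => e.1.1 < 3)%N (table p); last by apply.
have [p5|p5] := ltnP p 5; last by rewrite /table nth_default.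
by move: p p5 {i}; do 5!case=> //.
Qed.

Lemma bin2_rat n : 'C(n, 2)%:R = n%:R * (n%:R - 1) / 2 :> rat.
Proof.
elim: n => [|n IHn]; first by rewrite bin0n mul0r.
by rewrite binS natrD IHn bin1 -[n.+1]addn1 natrD; field.
Qed.

Lemma bin3_rat n : 'C(n, 3)%:R = n%:R * (n%:R - 1) * (n%:R - 2) / 6 :> rat.
Proof.
elim: n => [|n IHn]; first by rewrite bin0n !mul0r.
by rewrite binS natrD IHn bin2_rat -[n.+1]addn1 natrD; field.
Qed.

Lemma bin4_rat n :
  'C(n, 4)%:R = n%:R * (n%:R - 1) * (n%:R - 2) * (n%:R - 3) / 24 :> rat.
Proof.
elim: n => [|n IHn]; first by rewrite bin0n !mul0r.
by rewrite binS natrD IHn bin3_rat -[n.+1]addn1 natrD; field.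
Qed.

Theorem theorem4p4 (m : nat) (hm : (1 <= m)%N) :
  let a := ('C(m.-1, 0) + 'C(m.-1, 1) + 'C(m.-1, 2) + 'C(m.-1, 3)
            + 'C(m.-1, 4))%N in
  let b := (6 * 'C(m.-1, 1) + 33 * 'C(m.-1, 2) + 51 * 'C(m.-1, 3)
            + 23 * 'C(m.-1, 4))%N in
  let c := (4 * 'C(m.-1, 1) + 6 * 'C(m.-1, 2) + 3 * 'C(m.-1, 3))%N in
  let M : rat := m%:R in
  [/\ lmod_isomorphic (YB_homology m 4)
        ({ffun 'I_a -> k^o} * {ffun 'I_b -> cyclic_mod (1 - y2)}
         * {ffun 'I_c -> cyclic_mod (1 - y2 ^+ 2)})%type,
      a%:R = (M ^+ 4 - 6 * M ^+ 3 + 23 * M ^+ 2 - 18 * M + 24) / 24,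
      b%:R = (M - 1) * (23 * M ^+ 3 - 3 * M ^+ 2 - 26 * M + 24) / 24
    & c%:R = (M - 1) * (M ^+ 2 + M + 2) / 2].
Proof.
case: m hm => // q _ a b c M.
have ME : M = q%:R + 1 by rewrite /M -addn1 natrD.
split.
- rewrite -[in cyclic_mod (1 - y2)](expr1 y2).
  apply: (homology_cyclic_basis _ _ _ _ _
    (cyclic_basis_of_reduced table_reduced_cyclic_basis q)).
  + by rewrite expr0 subrr.
  + by move=> s; apply: table_degree_lt3.
  + rewrite card_table_degree (_ : degree_counts 0 = [:: 1; 1; 1; 1; 1]%N) //.
    by rewrite !big_ord_recr big_ord0 /a /=; lia.
  + rewrite card_table_degree (_ : degree_counts 1 = [:: 0; 6; 33; 51; 23]%N) //.
    by rewrite !big_ord_recr big_ord0 /b /=; lia.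
  + rewrite card_table_degree (_ : degree_counts 2 = [:: 0; 4; 6; 3; 0]%N) //.
    by rewrite !big_ord_recr big_ord0 /c /=; lia.
- by rewrite /a /= !natrD bin0 bin1 bin2_rat bin3_rat bin4_rat ME; field.
- by rewrite /b /= 3!natrD 4!natrM bin1 bin2_rat bin3_rat bin4_rat ME; field.
- by rewrite /c /= 2!natrD 3!natrM bin1 bin2_rat bin3_rat ME; field.
Qed.
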